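(* Let $G$ be a finite group and let $\mathcal C=\bigoplus_{g\in G}\mathcal C_g$ be a $G$-extension, i.e. a faithfully $G$-graded fusion category with trivial component $\mathcal C_e$. Then: (i) each $\mathcal C_g$, $g\in G$, is an invertible $\mathcal C_e$-bimodule category; (ii) for all $g,h\in G$ the functor $M_{g,h}:\mathcal C_g\boxtimes_{\mathcal C_e}\mathcal C_h\to\mathcal C_{gh}$ induced by the $\mathcal C_e$-balanced bifunctor $\otimes:\mathcal C_g\times\mathcal C_h\to\mathcal C_{gh}$ is an equivalence of $\mathcal C_e$-bimodule categories.
   Context: Fusion categories are over an algebraically closed field of characteristic $0$. A $G$-grading on $\mathcal C$ is a decomposition into full abelian subcategories $\mathcal C_g$ with $\otimes:\mathcal C_g\times\mathcal C_h\to\mathcal C_{gh}$; it is faithful if $\mathcal C_g\ne0$ for all $g$. Then $\mathcal C_e$ is a fusion category and each $\mathcal C_g$ is a $\mathcal C_e$-bimodule category. For a fusion category $\mathcal D$, a right $\mathcal D$-module category $\mathcal M$ and a left $\mathcal D$-module category $\mathcal N$, $\mathcal M\boxtimes_{\mathcal D}\mathcal N$ is the abelian category receiving the universal $\mathcal D$-balanced bifunctor from $\mathcal M\times\mathcal N$ (balanced: natural isomorphisms $F(M\otimes X,N)\cong F(M,X\otimes N)$, $X\in\mathcal D$, compatible with the associativity constraints). A $\mathcal D$-bimodule category $\mathcal M$ is invertible if $\mathcal M^{\mathrm{op}}\boxtimes_{\mathcal D}\mathcal M\cong\mathcal D$ and $\mathcal M\boxtimes_{\mathcal D}\mathcal M^{\mathrm{op}}\cong\mathcal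 D$ as $\mathcal D$-bimodule categories, where $\mathcal M^{\mathrm{op}}$ is the opposite category with actions twisted by duals. *)

(* Defs.v *)
From mathcomp Require Import all_boot all_order all_algebra all_fingroup.
Set Implicit Arguments.
Unset Strict Implicit.
Unset Printing Implicit Defensive.
Import GRing.Theory.

Declare Scope cat_scope.
Delimit Scope cat_scope with cat.
Local Open Scope ring_scope.
Local Open Scope cat_scope.

Record lincat (k : fieldType) := LinCat {
  obj :> Type;
  hom : obj -> obj -> lmodType k;
  idm : forall X, hom X X;
  comp : forall X Y Z, hom Y Z -> hom X Y -> hom X Z;
  compA : forall W X Y Z (h : hom Y Z) (g : hom X Y) (f : hom W X),
    comp h (comp g f) = comp (comp h g) f;
  comp1m : forall X Y (f : hom X Y), comp (idm Y) f = f;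
  compm1 : forall X Y (f : hom X Y), comp f (idm X) = f;
  compPl : forall X Y Z (a : k) (g g' : hom Y Z) (f : hom X Y),
    comp (a *: g + g') f = a *: comp g f + comp g' f;
  compPr : forall X Y Z (a : k) (g : hom Y Z) (f f' : hom X Y),
    comp g (a *: f + f') = a *: comp g f + comp g f'
}.
Arguments hom {k l} X Y.
Arguments idm {k l} X.
Arguments comp {k l X Y Z} g f.

Notation "g ∘ f" := (comp g f) (at level 40, left associativity) : cat_scope.
Notation "'\id'" := (idm _) (at level 0) : cat_scope.

Record iso (k : fieldType) (C : lincat k) (X Y : C) := Iso {
  fwd :> hom X Y;
  bwd : hom Y X;
  fwdK : bwd ∘ fwd = \id;
  bwdK : fwd ∘ bwd = \id
}.

Section Abelian.
Variables (k : fieldType) (C : lincat k).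

Definition is_iso (X Y : C) (f : hom X Y) :=
  exists g : hom Y X, g ∘ f = \id /\ f ∘ g = \id.

Definition mono (X Y : C) (f : hom X Y) :=
  forall W (g h : hom W X), f ∘ g = f ∘ h -> g = h.

Definition epi (X Y : C) (f : hom X Y) :=
  forall Z (g h : hom Y Z), g ∘ f = h ∘ f -> g = h.

Definition is_kernel (K X Y : C) (f : hom X Y) (m : hom K X) :=
  f ∘ m = 0 /\
  forall W (g : hom W X), f ∘ g = 0 -> exists! u : hom W K, m ∘ u = g.

Definition is_cokernel (X Y Q : C) (f : hom X Y) (q : hom Y Q) :=
  q ∘ f = 0 /\
  forall Z (g : hom Y Z), g ∘ f = 0 -> exists! u : hom Q Z, u ∘ q = g.

Definition is_dsum (I : finType) (S : I -> C) (X : C) :=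
  exists (i : forall j, hom (S j) X) (p : forall j, hom X (S j)),
    [/\ forall j, p j ∘ i j = \id,
        forall j l, j != l -> p j ∘ i l = 0
      & \sum_j i j ∘ p j = \id].

Definition abelian :=
  [/\ forall n (S : 'I_n -> C), exists X, is_dsum S X,
      forall (X Y : C) (f : hom X Y), exists K (m : hom K X), is_kernel f m,
      forall (X Y : C) (f : hom X Y), exists Q (q : hom Y Q), is_cokernel f q,
      forall (X Y : C) (m : hom X Y), mono m ->
        exists Z (f : hom Y Z), is_kernel f m
    & forall (Y Z : C) (q : hom Y Z), epi q ->
        exists X (f : hom X Y), is_cokernel f q].

Definition simple (X : C) :=
  idm X <> 0 /\ forall Y (m : hom Y X), mono m -> m = 0 \/ is_iso m.

Definition semisimple :=
  forall X : C, exists n (S : 'I_n -> C), (forall i, simple (S i)) /\ is_dsum S X.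

Definition finitely_many_simples :=
  exists n (S : 'I_n -> C), forall X, simple X -> exists i, inhabited (iso X (S i)).

Definition finite_dim_homs :=
  forall X Y : C, exists n (e : 'I_n -> hom X Y),
    forall f, exists c : 'I_n -> k, f = \sum_i c i *: e i.

End Abelian.

Record abcat (k : fieldType) := AbCat {
  ablin :> lincat k;
  abP : abelian ablin
}.

Record linfun (k : fieldType) (A B : lincat k) := LinFun {
  fobj :> A -> B;
  fmap : forall X Y, hom X Y -> hom (fobj X) (fobj Y);
  fmap1 : forall X, fmap (idm X) = \id;
  fmapM : forall X Y Z (g : hom Y Z) (f : hom X Y),
    fmap (g ∘ f) = fmap g ∘ fmap f;
  fmapP : forall X Y (a : k) (f g : hom X Y),
    fmap (a *: f + g) = a *: fmap f + fmap g
}.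
Arguments fmap {k A B} l {X Y} _.
Notation "F ⟪ f ⟫" := (fmap F f) (at level 2, left associativity, format "F ⟪ f ⟫") : cat_scope.

Record bifun (k : fieldType) (A B C : lincat k) := Bifun {
  bobj :> A -> B -> C;
  bmap : forall X X' Y Y', hom X X' -> hom Y Y' -> hom (bobj X Y) (bobj X' Y');
  bmap1 : forall X Y, bmap (idm X) (idm Y) = \id;
  bmapM : forall X X' X'' Y Y' Y'' (f' : hom X' X'') (f : hom X X')
                 (g' : hom Y' Y'') (g : hom Y Y'),
    bmap (f' ∘ f) (g' ∘ g) = bmap f' g' ∘ bmap f g;
  bmapPl : forall X X' Y Y' (a : k) (f f' : hom X X') (g : hom Y Y'),
    bmap (a *: f + f') g = a *: bmap f g + bmap f' g;
  bmapPr : forall X X' Y Y' (a : k) (f : hom X X') (g g' : hom Y Y'),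
    bmap f (a *: g + g') = a *: bmap f g + bmap f g'
}.
Arguments bmap {k A B C} b {X X' Y Y'} _ _.
Notation "F ⟪ f , g ⟫" := (bmap F f g) (at level 2, left associativity, format "F ⟪ f ,  g ⟫") : cat_scope.

Section Functors.
Variable k : fieldType.

Definition lf_id (A : lincat k) : linfun A A :=
  @LinFun k A A (fun X => X) (fun X Y f => f)
    (fun X => erefl) (fun X Y Z g f => erefl) (fun X Y a f g => erefl).

Definition lf_comp (A B C : lincat k) (G : linfun B C) (F : linfun A B) : linfun A C.
Proof.
refine (@LinFun k A C (fun X => G (F X)) (fun X Y f => G⟪F⟪f⟫⟫) _ _ _).
- by move=> X; rewrite !fmap1.
- by move=> X Y Z g f; rewrite !fmapM.
- by move=> X Y a f g; rewrite !fmapP.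
Defined.

Definition lf_bifun (A B C E : lincat k) (G : linfun C E) (F : bifun A B C) : bifun A B E.
Proof.
refine (@Bifun k A B E (fun X Y => G (F X Y)) (fun X X' Y Y' f g => G⟪F⟪f, g⟫⟫) _ _ _ _).
- by move=> X Y; rewrite bmap1 fmap1.
- by move=> *; rewrite bmapM fmapM.
- by move=> *; rewrite bmapPl fmapP.
- by move=> *; rewrite bmapPr fmapP.
Defined.

Definition lf_iso (A B : lincat k) (F : linfun A B) (X Y : A) (f : iso X Y) : iso (F X) (F Y).
Proof.
refine (@Iso k B (F X) (F Y) F⟪f⟫ F⟪bwd f⟫ _ _).
- by rewrite -fmapM fwdK fmap1.
- by rewrite -fmapM bwdK fmap1.
Defined.

Definition is_natural (A B : lincat k) (F G : linfun A B) (t : forall X, hom (F X) (G X)) :=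
  forall X Y (f : hom X Y), t Y ∘ F⟪f⟫ = G⟪f⟫ ∘ t X.

Definition is_natural2 (A B C : lincat k) (F G : bifun A B C)
    (t : forall X Y, hom (F X Y) (G X Y)) :=
  forall X X' Y Y' (f : hom X X') (g : hom Y Y'), t X' Y' ∘ F⟪f, g⟫ = G⟪f, g⟫ ∘ t X Y.

Definition naturally_iso (A B : lincat k) (F G : linfun A B) :=
  exists t : forall X, iso (F X) (G X), is_natural t.

Definition is_equivalence (A B : lincat k) (F : linfun A B) :=
  exists G : linfun B A,
    naturally_iso (lf_comp G F) (lf_id A) /\ naturally_iso (lf_comp F G) (lf_id B).

End Functors.

Record moncat (k : fieldType) := MonCat {
  moncarrier :> abcat k;
  tens : bifun moncarrier moncarrier moncarrier;
  munit : moncarrier;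
  massoc : forall X Y Z, iso (tens (tens X Y) Z) (tens X (tens Y Z));
  mlunit : forall X, iso (tens munit X) X;
  mrunit : forall X, iso (tens X munit) X;
  massoc_nat : forall X X' Y Y' Z Z' (f : hom X X') (g : hom Y Y') (h : hom Z Z'),
    massoc X' Y' Z' ∘ tens⟪tens⟪f, g⟫, h⟫ = tens⟪f, tens⟪g, h⟫⟫ ∘ massoc X Y Z;
  mlunit_nat : forall X X' (f : hom X X'), mlunit X' ∘ tens⟪\id, f⟫ = f ∘ mlunit X;
  mrunit_nat : forall X X' (f : hom X X'), mrunit X' ∘ tens⟪f, \id⟫ = f ∘ mrunit X;
  pentagon : forall W X Y Z,
    massoc W X (tens Y Z) ∘ massoc (tens W X) Y Z =
    tens⟪\id, massoc X Y Z⟫ ∘ massoc W (tens X Y) Z ∘ tens⟪massoc W X Y, \id⟫;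
  triangle : forall X Y,
    tens⟪\id, mlunit Y⟫ ∘ massoc X munit Y = tens⟪mrunit X, \id⟫
}.
Arguments tens {k m}.
Arguments munit {k m}.
Arguments massoc {k m} X Y Z.
Arguments mlunit {k m} X.
Arguments mrunit {k m} X.

Notation "X ⊗ Y" := (bobj tens X Y) (at level 40, left associativity) : cat_scope.
Notation "f ⊗⊗ g" := (bmap tens f g) (at level 40, left associativity) : cat_scope.
Notation "𝟙" := munit : cat_scope.

(* Conventions: X^* = ldual X has ev : X^* ⊗ X -> 1, and *X = rdual X has
   ev : X ⊗ *X -> 1. Duals are chosen; they are unique up to unique isomorphism. *)
Record rigidcat (k : fieldType) := RigidCat {
  rigcarrier :> moncat k;
  ldual : rigcarrier -> rigcarrier;
  lev : forall X, hom (ldual X ⊗ X) 𝟙;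
  lcoev : forall X, hom 𝟙 (X ⊗ ldual X);
  lzigzag1 : forall X,
    mrunit X ∘ (\id ⊗⊗ lev X) ∘ massoc X (ldual X) X ∘ (lcoev X ⊗⊗ \id) ∘ bwd (mlunit X) = \id;
  lzigzag2 : forall X,
    mlunit (ldual X) ∘ (lev X ⊗⊗ \id) ∘ bwd (massoc (ldual X) X (ldual X))
      ∘ (\id ⊗⊗ lcoev X) ∘ bwd (mrunit (ldual X)) = \id;
  rdual : rigcarrier -> rigcarrier;
  rev : forall X, hom (X ⊗ rdual X) 𝟙;
  rcoev : forall X, hom 𝟙 (rdual X ⊗ X);
  rzigzag1 : forall X,
    mlunit X ∘ (rev X ⊗⊗ \id) ∘ bwd (massoc X (rdual X) X) ∘ (\id ⊗⊗ rcoev X)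
      ∘ bwd (mrunit X) = \id;
  rzigzag2 : forall X,
    mrunit (rdual X) ∘ (\id ⊗⊗ rev X) ∘ massoc (rdual X) X (rdual X)
      ∘ (rcoev X ⊗⊗ \id) ∘ bwd (mlunit (rdual X)) = \id
}.
Arguments ldual {k r} X.
Arguments lev {k r} X.
Arguments lcoev {k r} X.
Arguments rdual {k r} X.
Arguments rev {k r} X.
Arguments rcoev {k r} X.

Definition is_fusion (k : fieldType) (C : rigidcat k) :=
  [/\ semisimple C, finitely_many_simples C, finite_dim_homs C & simple (munit : C)].

Record fusioncat (k : fieldType) := FusionCat {
  fuscarrier :> rigidcat k;
  fusP : is_fusion fuscarrier
}.

Record leftact (k : fieldType) (D : moncat k) (M : abcat k) := LeftAct {
  lact :> bifun D M M;
  la_assoc : forall X Y m, iso (lact (X ⊗ Y) m) (lact X (lact Y m));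
  la_unit : forall m, iso (lact 𝟙 m) m;
  la_assoc_nat : forall X X' Y Y' m m' (f : hom X X') (g : hom Y Y') (h : hom m m'),
    la_assoc X' Y' m' ∘ lact⟪f ⊗⊗ g, h⟫ = lact⟪f, lact⟪g, h⟫⟫ ∘ la_assoc X Y m;
  la_unit_nat : forall m m' (h : hom m m'), la_unit m' ∘ lact⟪\id, h⟫ = h ∘ la_unit m;
  la_pentagon : forall X Y Z m,
    la_assoc X Y (lact Z m) ∘ la_assoc (X ⊗ Y) Z m =
    lact⟪\id, la_assoc Y Z m⟫ ∘ la_assoc X (Y ⊗ Z) m ∘ lact⟪massoc X Y Z, \id⟫;
  la_triangle : forall X m,
    lact⟪\id, la_unit m⟫ ∘ la_assoc X 𝟙 m = lact⟪mrunit X, \id⟫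
}.

Record rightact (k : fieldType) (D : moncat k) (M : abcat k) := RightAct {
  ract :> bifun M D M;
  ra_assoc : forall m X Y, iso (ract (ract m X) Y) (ract m (X ⊗ Y));
  ra_unit : forall m, iso (ract m 𝟙) m;
  ra_assoc_nat : forall m m' X X' Y Y' (h : hom m m') (f : hom X X') (g : hom Y Y'),
    ra_assoc m' X' Y' ∘ ract⟪ract⟪h, f⟫, g⟫ = ract⟪h, f ⊗⊗ g⟫ ∘ ra_assoc m X Y;
  ra_unit_nat : forall m m' (h : hom m m'), ra_unit m' ∘ ract⟪h, \id⟫ = h ∘ ra_unit m;
  ra_pentagon : forall m X Y Z,
    ra_assoc m X (Y ⊗ Z) ∘ ra_assoc (ract m X) Y Z =
    ract⟪\id, massoc X Y Z⟫ ∘ ra_assoc m (X ⊗ Y) Z ∘ ract⟪ra_assoc m X Y, \id⟫;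
  ra_triangle : forall m X,
    ract⟪\id, mlunit X⟫ ∘ ra_assoc m 𝟙 X = ract⟪ra_unit m, \id⟫
}.

Record bimodcat (k : fieldType) (D : moncat k) := BimodCat {
  bimcarrier :> abcat k;
  bl : leftact D bimcarrier;
  br : rightact D bimcarrier;
  bmid : forall X m Y, iso (br (bl X m) Y) (bl X (br m Y));
  bmid_nat : forall X X' m m' Y Y' (f : hom X X') (h : hom m m') (g : hom Y Y'),
    bmid X' m' Y' ∘ br⟪bl⟪f, h⟫, g⟫ = bl⟪f, br⟪h, g⟫⟫ ∘ bmid X m Y;
  bmid_l : forall X Y m Z,
    la_assoc bl X Y (br m Z) ∘ bmid (X ⊗ Y) m Z =
    bl⟪\id, bmid Y m Z⟫ ∘ bmid X (bl Y m) Z ∘ br⟪la_assoc bl X Y m, \id⟫;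
  bmid_r : forall X m Y Z,
    bmid X m (Y ⊗ Z) ∘ ra_assoc br (bl X m) Y Z =
    bl⟪\id, ra_assoc br m Y Z⟫ ∘ bmid X (br m Y) Z ∘ br⟪bmid X m Y, \id⟫
}.
Arguments bl {k D} b.
Arguments br {k D} b.
Arguments bmid {k D b} X m Y.
Arguments la_assoc {k D M} l X Y m.
Arguments la_unit {k D M} l m.
Arguments ra_assoc {k D M} r m X Y.
Arguments ra_unit {k D M} r m.

Notation "X ▷ m" := (bobj (bl _) X m) (at level 40, left associativity) : cat_scope.
Notation "m ◁ X" := (bobj (br _) m X) (at level 40, left associativity) : cat_scope.
Notation "f ▷▷ g" := (bmap (bl _) f g) (at level 40, left associativity) : cat_scope.
Notation "f ◁◁ g" := (bmap (br _) f g) (at level 40, left associativity) : cat_scope.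

Record bimodfun_struct (k : fieldType) (D : moncat k) (P Q : bimodcat D) (K : linfun P Q) :=
  BimodFunStruct {
  kl : forall X p, iso (K (X ▷ p)) (X ▷ K p);
  kr : forall p Y, iso (K (p ◁ Y)) (K p ◁ Y);
  kl_nat : forall X X' p p' (f : hom X X') (h : hom p p'),
    kl X' p' ∘ K⟪f ▷▷ h⟫ = (f ▷▷ K⟪h⟫) ∘ kl X p;
  kr_nat : forall p p' Y Y' (h : hom p p') (g : hom Y Y'),
    kr p' Y' ∘ K⟪h ◁◁ g⟫ = (K⟪h⟫ ◁◁ g) ∘ kr p Y;
  kl_assoc : forall X Y p,
    la_assoc (bl Q) X Y (K p) ∘ kl (X ⊗ Y) p =
    (\id ▷▷ kl Y p) ∘ kl X (Y ▷ p) ∘ K⟪la_assoc (bl P) X Y p⟫;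
  kr_assoc : forall p X Y,
    kr p (X ⊗ Y) ∘ K⟪ra_assoc (br P) p X Y⟫ =
    ra_assoc (br Q) (K p) X Y ∘ (kr p X ◁◁ \id) ∘ kr (p ◁ X) Y;
  kl_unit : forall p, la_unit (bl Q) (K p) ∘ kl 𝟙 p = K⟪la_unit (bl P) p⟫;
  kr_unit : forall p, ra_unit (br Q) (K p) ∘ kr p 𝟙 = K⟪ra_unit (br P) p⟫;
  k_mid : forall X p Y,
    (\id ▷▷ kr p Y) ∘ kl X (p ◁ Y) ∘ K⟪bmid X p Y⟫ =
    bmid X (K p) Y ∘ (kl X p ◁◁ \id) ∘ kr (X ▷ p) Y
}.

Definition bimod_equivalent (k : fieldType) (D : moncat k) (P Q : bimodcat D) :=
  exists K : linfun P Q, inhabited (bimodfun_struct K) /\ is_equivalence K.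

Record balanced (k : fieldType) (D : moncat k) (M N : abcat k)
    (r : rightact D M) (l : leftact D N) (A : lincat k) := Balanced {
  balfun :> bifun M N A;
  bal : forall m X n, iso (balfun (r m X) n) (balfun m (l X n));
  bal_nat : forall m m' X X' n n' (h : hom m m') (f : hom X X') (h' : hom n n'),
    bal m' X' n' ∘ balfun⟪r⟪h, f⟫, h'⟫ = balfun⟪h, l⟪f, h'⟫⟫ ∘ bal m X n;
  bal_assoc : forall m X Y n,
    bal m X (l Y n) ∘ bal (r m X) Y n =
    balfun⟪\id, la_assoc l X Y n⟫ ∘ bal m (X ⊗ Y) n ∘ balfun⟪ra_assoc r m X Y, \id⟫
}.
Arguments bal {k D M N r l A} b m X n.

Definition lf_balanced (k : fieldType) (D : moncat k) (M N : abcat k)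
    (r : rightact D M) (l : leftact D N) (A B : lincat k) (K : linfun A B)
    (F : balanced r l A) : balanced r l B.
Proof.
refine (@Balanced k D M N r l B (lf_bifun K F) (fun m X n => lf_iso K (bal F m X n)) _ _).
- by move=> *; rewrite /= -!fmapM bal_nat.
- by move=> *; rewrite /= -!fmapM bal_assoc.
Defined.

Section Universal.
Variables (k : fieldType) (D : moncat k) (M N : abcat k).
Variables (r : rightact D M) (l : leftact D N).

Definition is_balanced_nat (A : lincat k) (F G : balanced r l A)
    (t : forall m n, hom (F m n) (G m n)) :=
  is_natural2 t /\
  forall m X n, bal G m X n ∘ t (r m X) n = t m (l X n) ∘ bal F m X n.

(* Composition with B is an equivalence, for every abelian category A, from
   linear functors T -> A to balanced bifunctors M x N -> A. No exactness is
   required: on semisimple categories every linear functor is exact. *)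
Definition is_universal (T : abcat k) (B : balanced r l T) :=
  forall A : abcat k,
    (forall F : balanced r l A, exists (K : linfun T A)
       (t : forall m n, iso (lf_balanced K B m n) (F m n)), is_balanced_nat t) /\
    (forall (K L : linfun T A) (t : forall m n, hom (K (B m n)) (L (B m n))),
       @is_balanced_nat A (lf_balanced K B) (lf_balanced L B) t ->
       exists s : forall x, hom (K x) (L x),
         [/\ is_natural s, forall m n, s (B m n) = t m n
           & forall s' : forall x, hom (K x) (L x),
               is_natural s' -> (forall m n, s' (B m n) = t m n) ->
               forall x, s' x = s x]).

End Universal.

(* A balanced bifunctor of D-bimodule categories: F : M x N -> P balanced over
   the inner actions and a D-bimodule functor with respect to the outer ones. *)
Record bimodbalanced (k : fieldType) (D : moncat k) (M N P : bimodcat D) := BimodBalanced {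
  bbal :> balanced (br M) (bl N) P;
  bb_l : forall X m n, iso (bbal (X ▷ m) n) (X ▷ bbal m n);
  bb_r : forall m n Y, iso (bbal m (n ◁ Y)) (bbal m n ◁ Y);
  bb_l_nat : forall X X' m m' n n' (f : hom X X') (h : hom m m') (h' : hom n n'),
    bb_l X' m' n' ∘ bbal⟪f ▷▷ h, h'⟫ = (f ▷▷ bbal⟪h, h'⟫) ∘ bb_l X m n;
  bb_r_nat : forall m m' n n' Y Y' (h : hom m m') (h' : hom n n') (g : hom Y Y'),
    bb_r m' n' Y' ∘ bbal⟪h, h' ◁◁ g⟫ = (bbal⟪h, h'⟫ ◁◁ g) ∘ bb_r m n Y;
  bb_l_assoc : forall X Y m n,
    la_assoc (bl P) X Y (bbal m n) ∘ bb_l (X ⊗ Y) m n =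
    (\id ▷▷ bb_l Y m n) ∘ bb_l X (Y ▷ m) n ∘ bbal⟪la_assoc (bl M) X Y m, \id⟫;
  bb_r_assoc : forall m n X Y,
    bb_r m n (X ⊗ Y) ∘ bbal⟪\id, ra_assoc (br N) n X Y⟫ =
    ra_assoc (br P) (bbal m n) X Y ∘ (bb_r m n X ◁◁ \id) ∘ bb_r m (n ◁ X) Y;
  bb_l_unit : forall m n,
    la_unit (bl P) (bbal m n) ∘ bb_l 𝟙 m n = bbal⟪la_unit (bl M) m, \id⟫;
  bb_r_unit : forall m n,
    ra_unit (br P) (bbal m n) ∘ bb_r m n 𝟙 = bbal⟪\id, ra_unit (br N) n⟫;
  bb_l_bal : forall X m Z n,
    bb_l X m (Z ▷ n) ∘ bal bbal (X ▷ m) Z n =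
    (\id ▷▷ bal bbal m Z n) ∘ bb_l X (m ◁ Z) n ∘ bbal⟪bmid X m Z, \id⟫;
  bb_r_bal : forall m Z n Y,
    (bal bbal m Z n ◁◁ \id) ∘ bb_r (m ◁ Z) n Y =
    bb_r m (Z ▷ n) Y ∘ bbal⟪\id, bwd (bmid Z n Y)⟫ ∘ bal bbal m Z (n ◁ Y);
  bb_mid : forall X m n Y,
    (\id ▷▷ bb_r m n Y) ∘ bb_l X m (n ◁ Y) =
    bmid X (bbal m n) Y ∘ (bb_l X m n ◁◁ \id) ∘ bb_r (X ▷ m) n Y
}.
Arguments bb_l {k D M N P} b X m n.
Arguments bb_r {k D M N P} b m n Y.

(* M ⊠_D N with its D-bimodule structure, which the universal property determines. *)
Record reltensor (k : fieldType) (D : moncat k) (M N : bimodcat D) := RelTensor {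
  rt :> bimodcat D;
  rt_bal : bimodbalanced M N rt;
  rt_univ : is_universal rt_bal
}.
Arguments rt_bal {k D M N} r.

Section IsoTheory.
Variables (k : fieldType) (C : lincat k).

Lemma compR (W X Y Z V : C) (f : hom Y Z) (g : hom X Y) (f' : hom V Z) (g' : hom X V)
  (e : f ∘ g = f' ∘ g') (h : hom W X) : f ∘ (g ∘ h) = f' ∘ (g' ∘ h).
Proof. by rewrite !compA e. Qed.

Lemma compR1 (W X Y Z : C) (f : hom Y Z) (g : hom X Y) (f' : hom X Z)
  (e : f ∘ g = f') (h : hom W X) : f ∘ (g ∘ h) = f' ∘ h.
Proof. by rewrite !compA e. Qed.

Lemma comp0m (X Y Z : C) (f : hom X Y) : (0 : hom Y Z) ∘ f = 0.
Proof. by have := compPl (-1) (0 : hom Y Z) 0 f; rewrite scaler0 addr0 scaleN1r addNr. Qed.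

Lemma compm0 (X Y Z : C) (f : hom Y Z) : f ∘ (0 : hom X Y) = 0.
Proof. by have := compPr (-1) f (0 : hom X Y) 0; rewrite scaler0 addr0 scaleN1r addNr. Qed.

Lemma iso_monic (X Y W : C) (f : iso X Y) (g h : hom W X) : f ∘ g = f ∘ h -> g = h.
Proof. by move=> e; rewrite -[g]comp1m -[h]comp1m -(fwdK f) -!compA e. Qed.

Lemma iso_epic (X Y W : C) (f : iso X Y) (g h : hom Y W) : g ∘ f = h ∘ f -> g = h.
Proof. by move=> e; rewrite -[g]compm1 -[h]compm1 -(bwdK f) !compA e. Qed.

Definition iso_inv (X Y : C) (f : iso X Y) : iso Y X := Iso (bwdK f) (fwdK f).

Definition iso_id (X : C) : iso X X := Iso (comp1m (idm X)) (comp1m (idm X)).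

Definition iso_comp (X Y Z : C) (g : iso Y Z) (f : iso X Y) : iso X Z.
Proof.
refine (@Iso k C X Z (g ∘ f) (bwd f ∘ bwd g) _ _).
- by rewrite -compA (compR1 (fwdK g)) comp1m fwdK.
- by rewrite -compA (compR1 (bwdK f)) comp1m bwdK.
Defined.

End IsoTheory.
Arguments iso_inv {k C X Y} & f.

Section BifunTheory.
Variables (k : fieldType) (A B C : lincat k) (F : bifun A B C).

Definition bif_iso (X X' : A) (Y Y' : B) (f : iso X X') (g : iso Y Y') :
  iso (F X Y) (F X' Y').
Proof.
refine (@Iso k C (F X Y) (F X' Y') F⟪f, g⟫ F⟪bwd f, bwd g⟫ _ _).
- by rewrite -bmapM !fwdK bmap1.
- by rewrite -bmapM !bwdK bmap1.
Defined.

Lemma bmap_l (X X' X'' : A) (Y : B) (f' : hom X' X'') (f : hom X X') :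
  F⟪f' ∘ f, idm Y⟫ = F⟪f', \id⟫ ∘ F⟪f, \id⟫.
Proof. by rewrite -bmapM comp1m. Qed.

Lemma bmap_r (X : A) (Y Y' Y'' : B) (g' : hom Y' Y'') (g : hom Y Y') :
  F⟪idm X, g' ∘ g⟫ = F⟪\id, g'⟫ ∘ F⟪\id, g⟫.
Proof. by rewrite -bmapM comp1m. Qed.

Lemma bmap_lr (X X' : A) (Y Y' : B) (f : hom X X') (g : hom Y Y') :
  F⟪f, \id⟫ ∘ F⟪\id, g⟫ = F⟪f, g⟫.
Proof. by rewrite -bmapM comp1m compm1. Qed.

Lemma bmap_rl (X X' : A) (Y Y' : B) (f : hom X X') (g : hom Y Y') :
  F⟪\id, g⟫ ∘ F⟪f, \id⟫ = F⟪f, g⟫.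
Proof. by rewrite -bmapM comp1m compm1. Qed.

End BifunTheory.

Lemma bmap_c (k : fieldType) (A B C : lincat k) (F : bifun A B C) (X X' : A) (Y Y' : B)
  (f : hom X X') (g : hom Y Y') : F⟪\id, g⟫ ∘ F⟪f, \id⟫ = F⟪f, \id⟫ ∘ F⟪\id, g⟫.
Proof. by rewrite bmap_rl bmap_lr. Qed.

Section MonTheory.
Variables (k : fieldType) (D : moncat k).
Implicit Types X Y Z W : D.

Lemma tens1_inj X Y (f g : hom X Y) : f ⊗⊗ idm 𝟙 = g ⊗⊗ idm 𝟙 -> f = g.
Proof. by move=> e; apply: (iso_epic (f := mrunit X)); rewrite -!mrunit_nat e. Qed.

Lemma tens1_injl X Y (f g : hom X Y) : idm 𝟙 ⊗⊗ f = idm 𝟙 ⊗⊗ g -> f = g.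
Proof. by move=> e; apply: (iso_epic (f := mlunit X)); rewrite -!mlunit_nat e. Qed.

Lemma mrunit_tens X Y : mrunit (X ⊗ Y) = (\id ⊗⊗ mrunit Y) ∘ massoc X Y 𝟙 :> hom _ _.
Proof.
apply: tens1_inj; apply: (iso_monic (f := massoc X Y 𝟙)).
rewrite -triangle -(bmap1 tens X Y) compA massoc_nat -compA pentagon.
by rewrite !compA -bmap_r triangle bmap_l !compA massoc_nat.
Qed.

Lemma mlunit_tens X Y : mlunit (X ⊗ Y) ∘ massoc 𝟙 X Y = mlunit X ⊗⊗ \id.
Proof.
apply: tens1_injl; rewrite bmap_r.
apply: (iso_epic (f := iso_comp (massoc 𝟙 (𝟙 ⊗ X) Y) (bif_iso tens (massoc 𝟙 𝟙 X) (iso_id Y)))) => /=.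
rewrite -!compA; have := pentagon 𝟙 𝟙 X Y; rewrite -compA => <-.
rewrite (compR1 (triangle _ _)) (compR (esym (massoc_nat _ _ _))).
by rewrite -(bmap1 tens X Y) -massoc_nat -bmap_l triangle.
Qed.

Lemma munit_eq : mlunit 𝟙 = mrunit 𝟙 :> hom (𝟙 ⊗ 𝟙) (𝟙 : D).
Proof.
apply: tens1_inj; rewrite -triangle -mlunit_tens; congr (_ ∘ _).
by apply: (iso_monic (f := mlunit 𝟙)); rewrite mlunit_nat.
Qed.

End MonTheory.

Section DualTheory.
Variables (k : fieldType) (D : rigidcat k).
Implicit Types X Y Z W : D.

Lemma iso_sq (C : lincat k) (A A' B B' : C) (a : iso A A') (b : iso B B')
  (f : hom B A) (g : hom B' A') : a ∘ f = g ∘ b -> bwd a ∘ g = f ∘ bwd b.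
Proof.
move=> e; apply: (iso_monic (f := a)); apply: (iso_epic (f := b)).
by rewrite -!compA (compR1 (bwdK a)) comp1m fwdK compm1 e.
Qed.

Lemma massoc_nat' X X' Y Y' Z Z' (f : hom X X') (g : hom Y Y') (h : hom Z Z') :
  bwd (massoc X' Y' Z') ∘ (f ⊗⊗ (g ⊗⊗ h)) = ((f ⊗⊗ g) ⊗⊗ h) ∘ bwd (massoc X Y Z).
Proof. by apply: iso_sq; rewrite massoc_nat. Qed.

Lemma pentagon1 W X Y Z :
  massoc (W ⊗ X) Y Z ∘ (bwd (massoc W X Y) ⊗⊗ \id) =
  bwd (massoc W X (Y ⊗ Z)) ∘ ((\id ⊗⊗ massoc X Y Z) ∘ massoc W (X ⊗ Y) Z).
Proof.
apply: (iso_monic (f := massoc W X (Y ⊗ Z))).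
rewrite (compR1 (bwdK _)) comp1m (compR (pentagon _ _ _ _)) -!compA.
by rewrite -bmap_l bwdK bmap1 compm1.
Qed.

Lemma pentagon2 W X Y Z :
  (massoc W X Y ⊗⊗ \id) ∘ bwd (massoc (W ⊗ X) Y Z) =
  bwd (massoc W (X ⊗ Y) Z) ∘ ((\id ⊗⊗ bwd (massoc X Y Z)) ∘ massoc W X (Y ⊗ Z)).
Proof.
apply: (iso_epic (f := massoc (W ⊗ X) Y Z)); rewrite -!compA fwdK compm1 pentagon.
rewrite -!compA (compR1 (esym (bmap_r _ _ _ _))) fwdK bmap1 comp1m.
by rewrite (compR1 (fwdK _)) comp1m.
Qed.

Definition cap X W : hom ((W ⊗ ldual X) ⊗ X) W :=
  locked (mrunit W ∘ ((\id ⊗⊗ lev X) ∘ massoc W (ldual X) X)).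

Definition cup X Z : hom Z ((Z ⊗ X) ⊗ ldual X) :=
  locked (bwd (massoc Z X (ldual X)) ∘ ((\id ⊗⊗ lcoev X) ∘ bwd (mrunit Z))).

Lemma capE X W : cap X W = mrunit W ∘ ((\id ⊗⊗ lev X) ∘ massoc W (ldual X) X).
Proof. by rewrite /cap -lock. Qed.

Lemma cupE X Z : cup X Z = bwd (massoc Z X (ldual X)) ∘ ((\id ⊗⊗ lcoev X) ∘ bwd (mrunit Z)).
Proof. by rewrite /cup -lock. Qed.

Lemma cap_nat X W W' (h : hom W W') : cap X W' ∘ ((h ⊗⊗ \id) ⊗⊗ \id) = h ∘ cap X W.
Proof.
rewrite !capE -!compA massoc_nat bmap1 (compR1 (bmap_rl _ _ _)) -bmap_lr.
by rewrite -!compA (compR (mrunit_nat _)).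
Qed.

Lemma cup_nat X Z Z' (h : hom Z Z') : cup X Z' ∘ h = ((h ⊗⊗ \id) ⊗⊗ \id) ∘ cup X Z.
Proof.
rewrite !cupE -!compA (iso_sq (mrunit_nat _)).
by rewrite (compR1 (bmap_rl _ _ _)) -bmap_lr -compA -(bmap1 tens X) (compR (massoc_nat' _ _ _)).
Qed.

Lemma snake1 X Z : cap X (Z ⊗ X) ∘ (cup X Z ⊗⊗ \id) = \id.
Proof.
rewrite capE cupE !bmap_l -!compA (compR (pentagon1 _ _ _ _)) -!compA.
rewrite (compR (massoc_nat _ _ _)) -(bmap1 tens Z X) (compR (esym (massoc_nat' _ _ _))).
rewrite mrunit_tens -!compA (compR1 (bwdK _)) comp1m.
have -> : massoc Z 𝟙 X ∘ (bwd (mrunit Z) ⊗⊗ \id) = \id ⊗⊗ bwd (mlunit X).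
  apply: (iso_monic (f := bif_iso tens (iso_id Z) (mlunit X))) => /=.
  by rewrite (compR1 (triangle _ _)) -bmap_l -bmap_r !bwdK !bmap1.
rewrite -!bmap_r; congr (_ ⊗⊗ _); rewrite -[RHS](lzigzag1 X) -!compA.
done.
Qed.

Lemma snake2 X W : (cap X W ⊗⊗ \id) ∘ cup X (W ⊗ ldual X) = \id.
Proof.
rewrite capE cupE !bmap_l -!compA (compR (pentagon2 _ _ _ _)) -!compA.
rewrite -(bmap1 tens W (ldual X)) (compR (massoc_nat _ _ _)).
rewrite (compR (esym (massoc_nat' _ _ _))).
have -> : massoc W (ldual X) 𝟙 ∘ bwd (mrunit (W ⊗ ldual X)) = \id ⊗⊗ bwd (mrunit (ldual X)).
  apply: (iso_monic (f := bif_iso tens (iso_id W) (mrunit (ldual X)))) => /=.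
  by rewrite compA -mrunit_tens -bmap_r !bwdK bmap1.
have E : (mrunit W ⊗⊗ idm (ldual X)) ∘ bwd (massoc W 𝟙 (ldual X)) = \id ⊗⊗ mlunit (ldual X).
  by rewrite -triangle -compA bwdK compm1.
rewrite (compR1 E) -!bmap_r; congr (_ ⊗⊗ _); rewrite -[RHS](lzigzag2 X) -!compA.
done.
Qed.

Definition curry X Z W (p : hom (Z ⊗ X) W) : hom Z (W ⊗ ldual X) :=
  locked ((p ⊗⊗ \id) ∘ cup X Z).

Lemma curryK X Z W (p : hom (Z ⊗ X) W) : cap X W ∘ (curry p ⊗⊗ \id) = p.
Proof. by rewrite /curry -lock bmap_l (compR (cap_nat _ _)) snake1 compm1. Qed.

Lemma cap_inj X Z W (f g : hom Z (W ⊗ ldual X)) :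
  cap X W ∘ (f ⊗⊗ \id) = cap X W ∘ (g ⊗⊗ \id) -> f = g.
Proof.
have E (h : hom Z (W ⊗ ldual X)) : h = (cap X W ∘ (h ⊗⊗ \id)) ⊗⊗ \id ∘ cup X Z.
  by rewrite bmap_l -compA -cup_nat (compR1 (snake2 _ _)) comp1m.
by move=> e; rewrite [f]E [g]E e.
Qed.

Lemma cap_unit X : cap X 𝟙 = lev X ∘ (mlunit (ldual X) ⊗⊗ \id).
Proof. by rewrite capE -munit_eq (compR (mlunit_nat _)) mlunit_tens. Qed.

Lemma lev_inj X Z (f g : hom Z (ldual X)) :
  lev X ∘ (f ⊗⊗ \id) = lev X ∘ (g ⊗⊗ \id) -> f = g.
Proof.
move=> e; apply: (iso_monic (f := iso_inv (mlunit (ldual X)))); apply: cap_inj.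
by rewrite cap_unit -!compA -!bmap_l /= !(compR1 (bwdK _)) !comp1m.
Qed.

Definition curry1 X Z (p : hom (Z ⊗ X) 𝟙) : hom Z (ldual X) :=
  locked (mlunit (ldual X) ∘ curry p).

Lemma curry1K X Z (p : hom (Z ⊗ X) 𝟙) : lev X ∘ (curry1 p ⊗⊗ \id) = p.
Proof. by rewrite /curry1 -lock bmap_l compA -cap_unit curryK. Qed.

Definition ldualm X Y (f : hom X Y) : hom (ldual Y) (ldual X) := curry1 (lev Y ∘ (\id ⊗⊗ f)).

Lemma ldualmE X Y (f : hom X Y) : lev X ∘ (ldualm f ⊗⊗ \id) = lev Y ∘ (\id ⊗⊗ f).
Proof. exact: curry1K. Qed.

Lemma ldualm1 X : ldualm (idm X) = \id.
Proof. by apply: lev_inj; rewrite ldualmE. Qed.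

Lemma ldualmM X Y Z (g : hom Y Z) (f : hom X Y) : ldualm (g ∘ f) = ldualm f ∘ ldualm g.
Proof.
apply: lev_inj; rewrite ldualmE bmap_l (compR (ldualmE _)) bmap_rl -[ldualm g ⊗⊗ f]bmap_lr.
by rewrite bmap_r (compR (ldualmE _)).
Qed.

Lemma ldualmP X Y (a : k) (f g : hom X Y) : ldualm (a *: f + g) = a *: ldualm f + ldualm g.
Proof.
by apply: lev_inj; rewrite ldualmE bmapPr bmapPl !compPr !ldualmE.
Qed.


Definition nest X Y : hom ((ldual Y ⊗ ldual X) ⊗ (X ⊗ Y)) 𝟙 :=
  locked (lev Y ∘ ((cap X (ldual Y) ⊗⊗ \id) ∘ bwd (massoc (ldual Y ⊗ ldual X) X Y))).

Lemma nest_unlock X Y : nest X Y =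
  lev Y ∘ ((cap X (ldual Y) ⊗⊗ \id) ∘ bwd (massoc (ldual Y ⊗ ldual X) X Y)).
Proof. by rewrite /nest -lock. Qed.

Lemma nestE X Y Z (f : hom Z (ldual Y ⊗ ldual X)) :
  nest X Y ∘ (f ⊗⊗ \id) =
  lev Y ∘ (((cap X (ldual Y) ∘ (f ⊗⊗ \id)) ⊗⊗ \id) ∘ bwd (massoc Z X Y)).
Proof. by rewrite nest_unlock bmap_l -!compA -massoc_nat' bmap1. Qed.

Lemma nest_inj X Y Z (f g : hom Z (ldual Y ⊗ ldual X)) :
  nest X Y ∘ (f ⊗⊗ \id) = nest X Y ∘ (g ⊗⊗ \id) -> f = g.
Proof.
rewrite !nestE !compA => e; apply: cap_inj; apply: lev_inj.
exact: (iso_epic (f := iso_inv (massoc Z X Y))) e.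
Qed.

Lemma ldual_tens_fwdK X Y :
  curry (curry1 (lev (X ⊗ Y) ∘ massoc (ldual (X ⊗ Y)) X Y)) ∘ curry1 (nest X Y) = \id.
Proof.
apply: nest_inj; rewrite bmap_l compA nestE curryK (compR1 (curry1K _)) -!compA.
by rewrite (compR1 (bwdK _)) comp1m curry1K bmap1 compm1.
Qed.

Lemma ldual_tens_bwdK X Y :
  curry1 (nest X Y) ∘ curry (curry1 (lev (X ⊗ Y) ∘ massoc (ldual (X ⊗ Y)) X Y)) = \id.
Proof.
apply: lev_inj; rewrite bmap_l (compR1 (curry1K _)) nestE curryK (compR1 (curry1K _)) -!compA bwdK.
by rewrite bmap1.
Qed.

Definition ldual_tens X Y : iso (ldual Y ⊗ ldual X) (ldual (X ⊗ Y)) :=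
  locked (Iso (ldual_tens_fwdK X Y) (ldual_tens_bwdK X Y)).

Lemma ldual_tensE X Y : lev (X ⊗ Y) ∘ (ldual_tens X Y ⊗⊗ \id) = nest X Y.
Proof. by rewrite /ldual_tens -lock /= curry1K. Qed.

Lemma ldual_unit_fwdK : (lev 𝟙 ∘ bwd (mrunit (ldual 𝟙))) ∘ curry1 (mlunit 𝟙) = \id :> hom 𝟙 (𝟙 : D).
Proof.
by rewrite -compA (iso_sq (mrunit_nat _)) (compR1 (curry1K _)) munit_eq bwdK.
Qed.

Lemma ldual_unit_bwdK : curry1 (mlunit 𝟙) ∘ (lev 𝟙 ∘ bwd (mrunit (ldual 𝟙))) = \id :> hom (ldual 𝟙) (ldual (𝟙 : D)).
Proof.
apply: lev_inj; rewrite bmap_l (compR1 (curry1K _)) munit_eq mrunit_nat -!compA fwdK.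
by rewrite bmap1.
Qed.

Definition ldual_unit : iso (𝟙 : D) (ldual 𝟙) := locked (Iso ldual_unit_fwdK ldual_unit_bwdK).

Lemma ldual_unitE : lev 𝟙 ∘ (ldual_unit ⊗⊗ \id) = mlunit (𝟙 : D).
Proof. by rewrite /ldual_unit -lock /= curry1K. Qed.

Lemma cap_natX X X' W (f : hom X X') :
  cap X W ∘ ((\id ⊗⊗ ldualm f) ⊗⊗ \id) = cap X' W ∘ (\id ⊗⊗ f).
Proof.
rewrite !capE -!compA massoc_nat (compR1 (esym (bmap_r _ _ _ _))) ldualmE.
by rewrite -(bmap1 tens W) massoc_nat bmap_r -!compA.
Qed.

Lemma cap_tens X W V : cap X (V ⊗ W) =
  (\id ⊗⊗ cap X W) ∘ (massoc V (W ⊗ ldual X) X ∘ (massoc V W (ldual X) ⊗⊗ \id)).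
Proof.
have P := pentagon V W (ldual X) X; rewrite -!compA in P.
rewrite !capE !bmap_r -!compA -P (compR (esym (massoc_nat _ _ _))) bmap1.
by rewrite mrunit_tens -!compA.
Qed.

Lemma nest_nat X X' Y Y' (f : hom X X') (g : hom Y Y') :
  nest X Y ∘ ((ldualm g ⊗⊗ ldualm f) ⊗⊗ \id) = nest X' Y' ∘ (\id ⊗⊗ (f ⊗⊗ g)).
Proof.
have E : cap X (ldual Y) ∘ ((ldualm g ⊗⊗ ldualm f) ⊗⊗ \id) =
    ldualm g ∘ (cap X' (ldual Y') ∘ (\id ⊗⊗ f)).
  by rewrite -[ldualm g ⊗⊗ _]bmap_lr bmap_l compA cap_nat -compA cap_natX.
rewrite nestE E bmap_l nest_unlock -!compA (compR (ldualmE _)) massoc_nat'.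
by congr (_ ∘ _); rewrite !compA -!bmapM !comp1m !compm1.
Qed.

Lemma ldual_tens_nat X X' Y Y' (f : hom X X') (g : hom Y Y') :
  ldualm (f ⊗⊗ g) ∘ ldual_tens X' Y' = ldual_tens X Y ∘ (ldualm g ⊗⊗ ldualm f).
Proof.
apply: lev_inj; rewrite !bmap_l (compR (ldualmE _)) (compR1 (ldual_tensE _ _)) nest_nat.
by rewrite bmap_rl -bmap_lr (compR1 (ldual_tensE _ _)).
Qed.


Lemma nest_assoc X Y Z :
  mrunit Z ∘ ((\id ⊗⊗ nest X Y) ∘ (massoc Z (ldual Y ⊗ ldual X) (X ⊗ Y)
    ∘ (massoc Z (ldual Y) (ldual X) ⊗⊗ \id))) =
  cap Y Z ∘ ((cap X (Z ⊗ ldual Y) ⊗⊗ \id) ∘ bwd (massoc ((Z ⊗ ldual Y) ⊗ ldual X) X Y)).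
Proof.
rewrite [cap Y Z]capE cap_tens nest_unlock !bmap_l !bmap_r -!compA.
rewrite (compR (massoc_nat _ _ _)); do 3 congr (_ ∘ _).
apply: (iso_epic (f := massoc _ _ _)); rewrite -!compA fwdK compm1.
have P := pentagon Z (ldual Y ⊗ ldual X) X Y; rewrite -!compA in P.
rewrite -(bmap1 tens X Y) -massoc_nat (compR P) -!compA.
by rewrite (compR1 (esym (bmap_r _ _ _ _))) fwdK bmap1 comp1m.
Qed.

Lemma ldual_tens_assoc X Y Z :
  ldual_tens (X ⊗ Y) Z ∘ ((\id ⊗⊗ ldual_tens X Y) ∘ massoc (ldual Z) (ldual Y) (ldual X)) =
  ldualm (massoc X Y Z) ∘ (ldual_tens X (Y ⊗ Z) ∘ (ldual_tens Y Z ⊗⊗ \id)).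
Proof.
apply: lev_inj.
transitivity (lev Z ∘ (((cap Y (ldual Z) ∘ ((cap X (ldual Z ⊗ ldual Y) ⊗⊗ \id)
  ∘ bwd (massoc ((ldual Z ⊗ ldual Y) ⊗ ldual X) X Y))) ⊗⊗ \id)
  ∘ bwd (massoc ((ldual Z ⊗ ldual Y) ⊗ ldual X) (X ⊗ Y) Z))).
  rewrite bmap_l (compR1 (ldual_tensE _ _)) nestE; congr (_ ∘ (_ ⊗⊗ _ ∘ _)).
  rewrite -nest_assoc bmap_l compA capE -!compA (compR (massoc_nat _ _ _)).
  by rewrite (compR1 (esym (bmap_r _ _ _ _))) ldual_tensE.
rewrite !bmap_l (compR (ldualmE _)) (compR (bmap_c _ _ _)) bmap_c.
rewrite (compR1 (ldual_tensE _ _)) (compR1 (nestE _)) cap_nat bmap_l -!compA.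
rewrite (compR1 (ldual_tensE _ _)) nest_unlock -!compA.
do 2 congr (_ ∘ _).
rewrite -(bmap1 tens Y Z) (compR (massoc_nat' _ _ _)); congr (_ ∘ _).
apply: (iso_monic (f := massoc _ _ _)).
by rewrite (compR (pentagon1 _ _ _ _)) -!compA bwdK compm1 (compR1 (bwdK _)) comp1m.
Qed.

Lemma ldual_tens_unitr X :
  ldual_tens X 𝟙 ∘ (ldual_unit ⊗⊗ \id) = ldualm (mrunit X) ∘ mlunit (ldual X).
Proof.
apply: lev_inj; rewrite !bmap_l (compR1 (ldual_tensE _ _)) nestE cap_nat bmap_l -compA.
rewrite (compR1 (ldual_unitE)) (compR (ldualmE _)) bmap_c munit_eq (compR (mrunit_nat _)).
rewrite cap_unit -!compA; do 2 congr (_ ∘ _).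
by rewrite mrunit_tens -compA bwdK compm1.
Qed.

Lemma ldual_tens_unitl X :
  ldual_tens 𝟙 X ∘ (\id ⊗⊗ ldual_unit) = ldualm (mlunit X) ∘ mrunit (ldual X).
Proof.
apply: lev_inj; rewrite !bmap_l (compR1 (ldual_tensE _ _)) nestE (compR (ldualmE _)).
have -> : cap 𝟙 (ldual X) ∘ ((\id ⊗⊗ ldual_unit) ⊗⊗ \id) = mrunit _ ∘ (mrunit _ ⊗⊗ \id).
  rewrite capE -!compA massoc_nat (compR1 (esym (bmap_r _ _ _ _))) ldual_unitE.
  by rewrite triangle.
rewrite bmap_l -!compA -massoc_nat' bmap1.
have E : (mrunit (ldual X) ⊗⊗ idm X) ∘ bwd (massoc _ 𝟙 X) = \id ⊗⊗ mlunit X.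
  by rewrite -triangle -compA bwdK compm1.
by rewrite (compR1 E).
Qed.

End DualTheory.
Arguments ldual_unit {k D}.

Lemma iso_sq_inv (k : fieldType) (C : lincat k) (A A' B B' : C) (a : iso A A') (b : iso B B')
  (f : hom A B) (g : hom A' B') : b ∘ f = g ∘ a -> f ∘ bwd a = bwd b ∘ g.
Proof. by move=> e; rewrite (iso_sq e). Qed.

Section RigidTheory.
Variables (k : fieldType) (D : rigidcat k).
Implicit Types X Y Z W : D.

Lemma ldual_tens_nat' X X' Y Y' (f : hom X X') (g : hom Y Y') :
  bwd (ldual_tens X Y) ∘ ldualm (f ⊗⊗ g) = (ldualm g ⊗⊗ ldualm f) ∘ bwd (ldual_tens X' Y').
Proof. by apply: iso_sq; rewrite ldual_tens_nat. Qed.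

Lemma ldual_tens_assoc' X Y Z :
  massoc (ldual Z) (ldual Y) (ldual X) ∘
    ((bwd (ldual_tens Y Z) ⊗⊗ \id) ∘ bwd (ldual_tens X (Y ⊗ Z))) =
  (\id ⊗⊗ bwd (ldual_tens X Y)) ∘ (bwd (ldual_tens (X ⊗ Y) Z) ∘ ldualm (massoc X Y Z)).
Proof.
apply: (iso_epic (f := ldual_tens X (Y ⊗ Z))).
apply: (iso_epic (f := bif_iso tens (ldual_tens Y Z) (iso_id (ldual X)))) => /=.
rewrite -!compA -ldual_tens_assoc.
rewrite (compR1 (fwdK _)) comp1m (compR1 (fwdK _)) comp1m -bmap_l fwdK bmap1 compm1.
by rewrite (compR1 (esym (bmap_r _ _ _ _))) fwdK bmap1 comp1m.
Qed.

Lemma ldual_tens_unitr' X :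
  bwd (ldual_tens X 𝟙) ∘ ldualm (mrunit X) = (ldual_unit ⊗⊗ \id) ∘ bwd (mlunit (ldual X)).
Proof. by apply: iso_sq; rewrite ldual_tens_unitr. Qed.

Lemma ldual_tens_unitl' X :
  bwd (ldual_tens 𝟙 X) ∘ ldualm (mlunit X) = (\id ⊗⊗ ldual_unit) ∘ bwd (mrunit (ldual X)).
Proof. by apply: iso_sq; rewrite ldual_tens_unitl. Qed.

End RigidTheory.

Section Opposite.
Variable k : fieldType.

Definition oplin (C : lincat k) : lincat k :=
  @LinCat k C (fun X Y => hom Y X) (fun X => idm X) (fun X Y Z g f => f ∘ g)
    (fun W X Y Z h g f => esym (compA f g h))
    (fun X Y f => compm1 f) (fun X Y f => comp1m f)
    (fun X Y Z a g g' f => compPr a f g g')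
    (fun X Y Z a g f f' => compPl a f f' g).

Definition opiso (C : lincat k) (X Y : C) (f : iso X Y) : @iso k (oplin C) Y X :=
  @Iso k (oplin C) Y X (fwd f) (bwd f) (bwdK f) (fwdK f).

Lemma op_dsum (C : lincat k) (I : finType) (S : I -> C) (X : C) :
  is_dsum S X -> @is_dsum k (oplin C) I S X.
Proof.
case=> i [p [pi0 pi1 ip]]; exists p, i; split=> // j l jl /=.
by rewrite pi1 // eq_sym.
Qed.

Lemma op_abelian (C : lincat k) : abelian C -> abelian (oplin C).
Proof.
case=> sums kers coks monos epis; split.
- by move=> n S; have [X HX] := sums n S; exists X; apply: op_dsum.
- by move=> X Y f; apply: (coks Y X f).
- by move=> X Y f; apply: (kers Y X f).
- by move=> X Y m mm; apply: (epis Y X m).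
- by move=> X Y m mm; apply: (monos Y X m).
Qed.

Definition opcat (C : abcat k) : abcat k := AbCat (op_abelian (abP C)).

End Opposite.

(* M^op, with the actions X · m = m ◁ X^* and m · Y = Y^* ▷ m. The same kind of
   dual is used on both sides, so that X |-> *X is an equivalence D^op -> D of
   bimodule categories; mixing X^* and *X would twist one action by the double dual. *)
Section OpBimod.
Variables (k : fieldType) (D : rigidcat k) (M : bimodcat D).

Definition op_lact : bifun D (opcat M) (opcat M).
Proof.
refine (@Bifun k D (opcat M) (opcat M) (fun X m => m ◁ ldual X)
  (fun X X' m m' f h => h ◁◁ ldualm f) _ _ _ _).
- by move=> X m; rewrite ldualm1 bmap1.
- by move=> *; rewrite /= ldualmM bmapM.
- by move=> *; rewrite /= ldualmP bmapPr.
- by move=> *; rewrite /= bmapPl.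
Defined.

Definition op_ract : bifun (opcat M) D (opcat M).
Proof.
refine (@Bifun k (opcat M) D (opcat M) (fun m Y => ldual Y ▷ m)
  (fun m m' Y Y' h g => ldualm g ▷▷ h) _ _ _ _).
- by move=> m Y; rewrite ldualm1 bmap1.
- by move=> *; rewrite /= ldualmM bmapM.
- by move=> *; rewrite /= bmapPr.
- by move=> *; rewrite /= ldualmP bmapPl.
Defined.

Definition op_leftact : leftact D (opcat M).
Proof.
refine (@LeftAct k D (opcat M) op_lact
  (fun X Y (m : M) => opiso (iso_comp (bif_iso (br M) (@iso_id k M m) (ldual_tens X Y))
                                (ra_assoc (br M) m (ldual Y) (ldual X))))
  (fun m : M => opiso (iso_comp (bif_iso (br M) (@iso_id k M m) ldual_unit)
                            (iso_inv (ra_unit (br M) m)))) _ _ _ _) => /=.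
- move=> X X' Y Y' m m' f g h.
  rewrite -!compA ra_assoc_nat !compA; congr (_ ∘ _).
  by rewrite -!bmapM ldual_tens_nat comp1m compm1.
- move=> m m' h; rewrite ldualm1 -!compA (iso_sq (ra_unit_nat _ _)) !compA; congr (_ ∘ _).
  by rewrite bmap_lr bmap_rl.
- move=> X Y Z m.
  have P := ra_pentagon (br M) m (ldual Z) (ldual Y) (ldual X); rewrite -!compA in P.
  rewrite ldualm1 -!compA bmap_l.
  rewrite [in RHS](compR (ra_assoc_nat _ _ _ _)).
  rewrite -[in LHS](bmap1 (br M) m (ldual Z)) [in LHS](compR (ra_assoc_nat _ _ _ _)) P.
  by rewrite !compA -!bmap_r -!compA ldual_tens_assoc.
- move=> X m; rewrite ldualm1 bmap_l -!compA (compR (ra_assoc_nat _ _ _ _)) compA -bmap_r.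
  rewrite ldual_tens_unitr bmap_r -compA (compR1 (ra_triangle _ _ _)) -bmap_l bwdK bmap1.
  by rewrite compm1.
Defined.

Definition op_rightact : rightact D (opcat M).
Proof.
refine (@RightAct k D (opcat M) op_ract
  (fun (m : M) X Y => opiso (iso_comp (la_assoc (bl M) (ldual Y) (ldual X) m)
     (bif_iso (bl M) (iso_inv (ldual_tens X Y)) (@iso_id k M m))))
  (fun m : M => opiso (iso_comp (bif_iso (bl M) ldual_unit (@iso_id k M m))
                                (iso_inv (la_unit (bl M) m)))) _ _ _ _) => /=.
- move=> m m' X X' Y Y' h f g.
  rewrite -[RHS]compA -bmapM ldual_tens_nat' comp1m -[h in RHS]compm1 bmapM.
  by rewrite [RHS]compA la_assoc_nat -compA.
- move=> m m' h; rewrite ldualm1 -!compA (iso_sq (la_unit_nat _ _)) !compA; congr (_ ∘ _).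
  by rewrite bmap_lr bmap_rl.
- move=> m X Y Z.
  have P := la_pentagon (bl M) (ldual Z) (ldual Y) (ldual X) m; rewrite -!compA in P.
  rewrite ldualm1 -!compA bmap_r -!compA.
  rewrite -[in LHS](bmap1 (bl M) (ldual X) m) [in LHS](compR (esym (la_assoc_nat _ _ _ _))).
  rewrite [in RHS](compR (esym (la_assoc_nat _ _ _ _))) (compR P) -!compA.
  by rewrite -!bmap_l ldual_tens_assoc'.
- move=> m X; rewrite ldualm1 bmap_r -!compA -bmap_l ldual_tens_unitl' bmap_l.
  rewrite (compR (la_assoc_nat _ _ _ _)); congr (_ ∘ _).
  apply: (iso_monic (f := bif_iso (bl M) (iso_id (ldual X)) (la_unit (bl M) m))) => /=.
  by rewrite (compR1 (la_triangle _ _ _)) -bmap_l -bmap_r !bwdK !bmap1.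
Defined.

Definition opbimod : bimodcat D.
Proof.
refine (@BimodCat k D (opcat M) op_leftact op_rightact
  (fun X (m : M) Y => opiso (bmid (ldual Y) m (ldual X))) _ _ _) => /=.
- by move=> X X' m m' Y Y' f h g; rewrite bmid_nat.
- move=> X Y m Z; rewrite ldualm1.
  have P := bmid_r (ldual Z) m (ldual Y) (ldual X); rewrite -!compA in P.
  by rewrite ldualm1 bmap_r -!compA -P -(bmap1 (bl M) (ldual Z) m) (compR (bmid_nat _ _ _)).
- move=> X m Y Z.
  have P := bmid_l (ldual Z) (ldual Y) m (ldual X); rewrite -!compA in P.
  rewrite !ldualm1 bmap_l -!compA.
  by rewrite -[in LHS](bmap1 (br M) m (ldual X)) -[in LHS]bmid_nat [in LHS](compR P) -!compA.
Defined.

End OpBimod.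

Section FullSub.
Variables (k : fieldType) (C : lincat k).

Definition fullsub (P : C -> Prop) : lincat k :=
  @LinCat k {X : C | P X} (fun X Y => hom (sval X) (sval Y)) (fun X => idm (sval X))
    (fun X Y Z g f => g ∘ f)
    (fun W X Y Z h g f => compA h g f) (fun X Y f => comp1m f) (fun X Y f => compm1 f)
    (fun X Y Z a g g' f => compPl a g g' f) (fun X Y Z a g f f' => compPr a g f f').

Definition subiso (P : C -> Prop) (X Y : fullsub P) (f : iso (sval X) (sval Y)) : iso X Y :=
  @Iso k (fullsub P) X Y (fwd f) (bwd f) (fwdK f) (bwdK f).

End FullSub.
Arguments subiso {k C P X Y} & f.

(* C = ⊕_g C_g, where C_g is the full (replete) subcategory on the X with deg g X. *)
Record grading (gT : finGroupType) (k : fieldType) (C : moncat k) := Grading {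
  deg : gT -> C -> Prop;
  deg_iso : forall g (X Y : C), iso X Y -> deg g X -> deg g Y;
  deg_abelian : forall g, abelian (fullsub (deg g));
  deg_hom : forall g h (X Y : C) (f : hom X Y), g != h -> deg g X -> deg h Y -> f = 0;
  deg_dsum : forall X : C, exists S : gT -> C, (forall g, deg g (S g)) /\ is_dsum S X;
  deg_tens : forall g h (X Y : C), deg g X -> deg h Y -> deg (g * h)%g (X ⊗ Y)
}.

Definition faithful_grading (gT : finGroupType) (k : fieldType) (C : moncat k)
    (E : grading gT C) :=
  forall g, exists X : C, deg E g X /\ idm X <> 0.

Definition component (gT : finGroupType) (k : fieldType) (C : moncat k) (E : grading gT C)
  (g : gT) : abcat k := AbCat (deg_abelian E g).

Section Extension.
Variables (gT : finGroupType) (k : fieldType) (C : fusioncat k) (E : grading gT C).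
Local Notation "''C_' g" := (component E g) (at level 8, g at level 2, format "''C_' g").

Lemma bmap0r (A B A' : lincat k) (F : bifun A B A') X X' Y Y' (f : hom X X') :
  F⟪f, 0 : hom Y Y'⟫ = 0.
Proof. by have := bmapPr F (-1) f (0 : hom Y Y') 0; rewrite scaler0 addr0 scaleN1r addNr. Qed.

Lemma bmap0l (A B A' : lincat k) (F : bifun A B A') X X' Y Y' (g : hom Y Y') :
  F⟪0 : hom X X', g⟫ = 0.
Proof. by have := bmapPl F (-1) (0 : hom X X') 0 g; rewrite scaler0 addr0 scaleN1r addNr. Qed.

Lemma deg_eq g g' (X : C) : g = g' -> deg E g X -> deg E g' X.
Proof. by move->. Qed.

Lemma deg_of_hom0 (X : C) g :
  (forall h (Y : C) (f : hom X Y), h != g -> deg E h Y -> f = 0) -> deg E g X.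
Proof.
move=> H; have [S [degS [i [p [pi1 pi0 ip]]]]] := deg_dsum E X.
apply: deg_iso (degS g); refine (@Iso k C (S g) X (i g) (p g) (pi1 g) _).
rewrite -ip (bigD1 g) //= big1 ?addr0 // => h hg.
by rewrite (H h _ (p h) hg (degS h)) compm0.
Qed.

Lemma deg_munit : deg E 1%g (munit : C).
Proof.
have [_ _ _ [id0 simp]] := fusP C.
have [S [degS [i [p [pi1 pi0 ip]]]]] := deg_dsum E (munit : C).
have [g ipg] : exists g, i g ∘ p g != 0.
  case: (pickP (fun g => i g ∘ p g != 0)) => [g ipg|H]; first by exists g.
  by case: id0; rewrite -ip big1 // => g _; apply/eqP; move/negbFE: (H g).
have mi : mono (i g).
  by move=> W a b ab; rewrite -[a]comp1m -[b]comp1m -(pi1 g) -!compA ab.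
have degu : deg E g (munit : C).
  case: (simp _ _ mi) => [i0|[q [qi iq]]]; first by rewrite i0 comp0m eqxx in ipg.
  exact: deg_iso (Iso qi iq) (degS g).
case: (eqVneq (g * g)%g g) => [gg|gg].
  by apply: deg_eq degu; apply: (mulgI g); rewrite gg mulg1.
have l0 := deg_hom (mlunit 𝟙 : hom _ _) gg (deg_tens degu degu) degu.
by case: id0; rewrite -(bwdK (mlunit 𝟙)) l0 comp0m.
Qed.

Lemma deg_ldual g (X : C) : deg E g X -> deg E g^-1%g (ldual X).
Proof.
move=> dX; apply: deg_of_hom0 => h Y f hg dY.
have e0 : (\id ⊗⊗ f) ∘ lcoev X = 0.
  apply: (deg_hom _ _ deg_munit (deg_tens dX dY)).
  by apply: contra hg => /eqP e; rewrite -(mulKg g h) -e mulg1.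
rewrite -[f]compm1 -(lzigzag2 X) -!compA (compR (esym (mlunit_nat _))) (compR (bmap_c _ _ _)).
rewrite -(bmap1 tens (ldual X) X) (compR (esym (massoc_nat' _ _ _))).
by rewrite (compR1 (esym (bmap_r _ _ _ _))) e0 bmap0r !(compm0, comp0m).
Qed.

Lemma deg_rdual g (X : C) : deg E g X -> deg E g^-1%g (rdual X).
Proof.
move=> dX; apply: deg_of_hom0 => h Y f hg dY.
have e0 : (f ⊗⊗ \id) ∘ rcoev X = 0.
  apply: (deg_hom _ _ deg_munit (deg_tens dY dX)).
  by apply: contra hg => /eqP e; rewrite -(mulgK g h) -e mul1g.
rewrite -[f]compm1 -(rzigzag2 X) -!compA (compR (esym (mrunit_nat _))) (compR (esym (bmap_c _ _ _))).
rewrite -(bmap1 tens X (rdual X)) (compR (esym (massoc_nat _ _ _))).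
by rewrite (compR1 (esym (bmap_l _ _ _ _))) e0 bmap0l !(compm0, comp0m).
Qed.

Definition component_tens g h gh (e : (g * h)%g = gh) : bifun 'C_g 'C_h 'C_gh :=
  @Bifun k 'C_g 'C_h 'C_gh
    (fun X Y => exist _ (sval X ⊗ sval Y) (deg_eq e (deg_tens (svalP X) (svalP Y))))
    (fun X X' Y Y' f g => f ⊗⊗ g)
    (fun X Y => bmap1 tens (sval X) (sval Y))
    (fun X X' X'' Y Y' Y'' f' f g' g => bmapM tens f' f g' g)
    (fun X X' Y Y' a f f' g => bmapPl tens a f f' g)
    (fun X X' Y Y' a f g g' => bmapPr tens a f g g').

Definition trivial_moncat : moncat k.
Proof.
refine (@MonCat k 'C_(1%g) (component_tens (mulg1 1%g)) (exist _ 𝟙 deg_munit)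
  (fun X Y Z => subiso (massoc (sval X) (sval Y) (sval Z)))
  (fun X => subiso (mlunit (sval X))) (fun X => subiso (mrunit (sval X))) _ _ _ _ _) => /=.
- by move=> *; apply: massoc_nat.
- by move=> *; apply: mlunit_nat.
- by move=> *; apply: mrunit_nat.
- by move=> *; apply: pentagon.
- by move=> *; apply: triangle.
Defined.

Definition trivial_component : rigidcat k.
Proof.
refine (@RigidCat k trivial_moncat
  (fun X => exist _ (ldual (sval X)) (deg_eq (invg1 _) (deg_ldual (svalP X))))
  (fun X => lev (sval X)) (fun X => lcoev (sval X)) _ _
  (fun X => exist _ (rdual (sval X)) (deg_eq (invg1 _) (deg_rdual (svalP X))))
  (fun X => rev (sval X)) (fun X => rcoev (sval X)) _ _) => /=.
- by move=> X; apply: lzigzag1.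
- by move=> X; apply: lzigzag2.
- by move=> X; apply: rzigzag1.
- by move=> X; apply: rzigzag2.
Defined.

Definition component_leftact (g : gT) : leftact trivial_component 'C_g.
Proof.
refine (@LeftAct k trivial_component 'C_g (component_tens (mul1g g))
  (fun X Y Z => subiso (massoc (sval X) (sval Y) (sval Z)))
  (fun X => subiso (mlunit (sval X))) _ _ _ _) => /=.
- by move=> *; apply: massoc_nat.
- by move=> *; apply: mlunit_nat.
- by move=> *; apply: pentagon.
- by move=> *; apply: triangle.
Defined.

Definition component_rightact (g : gT) : rightact trivial_component 'C_g.
Proof.
refine (@RightAct k trivial_component 'C_g (component_tens (mulg1 g))
  (fun X Y Z => subiso (massoc (sval X) (sval Y) (sval Z)))
  (fun X => subiso (mrunit (sval X))) _ _ _ _) => /=.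
- by move=> *; apply: massoc_nat.
- by move=> *; apply: mrunit_nat.
- by move=> *; apply: pentagon.
- by move=> *; apply: triangle.
Defined.

Definition component_bimod (g : gT) : bimodcat trivial_component.
Proof.
refine (@BimodCat k trivial_component 'C_g (component_leftact g) (component_rightact g)
  (fun X Y Z => subiso (massoc (sval X) (sval Y) (sval Z))) _ _ _) => /=.
- by move=> *; apply: massoc_nat.
- by move=> *; apply: pentagon.
- by move=> *; apply: pentagon.
Defined.

Definition tens_balanced (g h : gT) :
  balanced (br (component_bimod g)) (bl (component_bimod h)) (component_bimod (g * h)%g).
Proof.
refine (@Balanced k trivial_component 'C_g 'C_h (component_rightact g)
  (component_leftact h) 'C_(g * h)%g (component_tens erefl)
  (fun X Y Z => subiso (massoc (sval X) (sval Y) (sval Z))) _ _) => /=.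
- by move=> *; apply: massoc_nat.
- by move=> *; apply: pentagon.
Defined.

Definition tens_bimodbalanced (g h : gT) :
  bimodbalanced (component_bimod g) (component_bimod h) (component_bimod (g * h)%g).
Proof.
refine (@BimodBalanced k trivial_component (component_bimod g) (component_bimod h)
  (component_bimod (g * h)%g) (tens_balanced g h)
  (fun X Y Z => subiso (massoc (sval X) (sval Y) (sval Z)))
  (fun X Y Z => iso_inv (subiso (massoc (sval X) (sval Y) (sval Z)))) _ _ _ _ _ _ _ _ _) => /=.
- by move=> *; apply: massoc_nat.
- by move=> *; apply: massoc_nat'.
- by move=> *; apply: pentagon.
- by move=> *; rewrite pentagon1 -!compA bwdK compm1.
- by move=> *; apply: mlunit_tens.
- by move=> *; rewrite mrunit_tens -compA bwdK compm1.
- by move=> *; apply: pentagon.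
- by move=> *; rewrite pentagon2 -compA.
- move=> X m n Y.
  apply: (iso_monic (f := bif_iso tens (iso_id (sval X)) (massoc (sval m) (sval n) (sval Y)))) => /=.
  rewrite (compR1 (esym (bmap_r _ _ _ _))) bwdK bmap1 comp1m !compA -pentagon.
  by rewrite -compA bwdK compm1.
Defined.

End Extension.

Section Invertible.
Variables (k : fieldType) (D : rigidcat k).

Definition regular_bimod : bimodcat D :=
  @BimodCat k D D
    (@LeftAct k D D tens massoc mlunit (@massoc_nat k D) (@mlunit_nat k D)
       (@pentagon k D) (@triangle k D))
    (@RightAct k D D tens massoc mrunit
       (fun X X' Y Y' Z Z' f g h => massoc_nat f g h) (@mrunit_nat k D)
       (@pentagon k D) (@triangle k D))
    massoc (fun X X' Y Y' Z Z' f g h => massoc_nat f g h) (@pentagon k D) (@pentagon k D).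

Definition reltensor_equivalent (M N P : bimodcat D) :=
  inhabited (reltensor M N) /\ forall T : reltensor M N, bimod_equivalent T P.

Definition invertible_bimod (M : bimodcat D) :=
  reltensor_equivalent (opbimod M) M regular_bimod /\
  reltensor_equivalent M (opbimod M) regular_bimod.

(* K, with the structure s, is a D-bimodule functor T -> P through which F
   factors, by t, as a balanced D-bimodule functor. *)
Definition is_bimod_factorization (M N P : bimodcat D) (F : bimodbalanced M N P)
    (T : reltensor M N) (K : linfun T P) (t : forall m n, iso (K (rt_bal T m n)) (F m n))
    (s : bimodfun_struct K) :=
  (forall X m n, bb_l F X m n ∘ t (X ▷ m) n =
     (\id ▷▷ t m n) ∘ kl s X (rt_bal T m n) ∘ K⟪bb_l (rt_bal T) X m n⟫) /\
  (forall m n Y, bb_r F m n Y ∘ t m (n ◁ Y) =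
     (t m n ◁◁ \id) ∘ kr s (rt_bal T m n) Y ∘ K⟪bb_r (rt_bal T) m n Y⟫).

(* M ⊠_D N exists and the functor K : M ⊠_D N -> P induced by F (unique up to
   unique isomorphism) is, with its induced structure, an equivalence of
   D-bimodule categories. *)
Definition induces_bimod_equivalence (M N P : bimodcat D) (F : bimodbalanced M N P) :=
  inhabited (reltensor M N) /\
  forall (T : reltensor M N) (K : linfun T P)
         (t : forall m n, iso (K (rt_bal T m n)) (F m n)),
    @is_balanced_nat k D M N (br M) (bl N) P (lf_balanced K (rt_bal T)) F t ->
    (exists s : bimodfun_struct K, is_bimod_factorization t s) /\ is_equivalence K.

End Invertible.

(* Main.v *)
(** Every morphism m ⊗ n -> m' ⊗ n' of C is a composite
    m ⊗ n -> (m' ⊗ Y) ⊗ n = m' ⊗ (Y ⊗ n) -> m' ⊗ n' with Y in C_e, and by duality it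
    determines this composite up to moving a morphism of C_e across the middle (take
    Y = n' ⊗ n^∨).  A balanced bifunctor F on C_g x C_h therefore extends to all morphisms
    between the objects m ⊗ n.  If 0 <> Y in C_h, the evaluation Y^∨ ⊗ Y -> 1 splits, so
    every Z in C_gh is a retract of (Z ⊗ Y^∨) ⊗ Y, and F extends to C_gh by splitting
    idempotents: ⊗ is a universal balanced bifunctor.  Left duality is a bimodule
    equivalence from C_{g^-1} to the opposite of C_g, so composing ⊗ with a quasi-inverse
    of it gives the two universal bifunctors that make C_g invertible. *)

Require Import Defs.
From mathcomp Require Import all_boot all_order all_algebra all_fingroup.
From Stdlib Require Import ClassicalEpsilon.
(* [hom] of MathComp's [vector] would otherwise shadow that of [Defs]. *)
Import Defs.
Set Implicit Arguments.
Unset Strict Implicit.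
Unset Printing Implicit Defensive.
Import GRing.Theory.
Local Open Scope ring_scope.
Local Open Scope cat_scope.


(** The universal property assumes no exactness, so the objects of C_gh have to be reached from the
    objects m ⊗ n by a construction that every linear functor respects: splitting an idempotent
    rather than taking a cokernel. This is where semisimplicity enters, through the splitting of the
    evaluation. The two facts about ⊗ are isolated as [span_presented] and [dominant]. They speak of
    the bifunctor alone, with no target category to quantify over, and so can be carried along
    functors that are fully faithful and essentially surjective, which is what invertibility uses.
    Both claims concern every model of the relative tensor product. One universal bifunctor is
    enough: two of them are related by an equivalence, and the uniqueness in the universal property
    forces the bimodule structure of that equivalence and proves its coherence. *)

Lemma dep_choice (I : Type) (P : I -> Type) (Q : forall i, P i -> Prop) :
  (forall i, exists y, Q i y) -> exists f : forall i, P i, forall i, Q i (f i).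
Proof.
move=> H; exists (fun i => sval (constructive_indefinite_description _ (H i))) => i.
exact: svalP (constructive_indefinite_description _ (H i)).
Qed.

Lemma compR2 (k : fieldType) (A : lincat k) (V W X Y Z : A) (f : hom Y Z) (g : hom X Y)
    (h : hom W X) (x : hom W Z) (e : f ∘ (g ∘ h) = x) (w : hom V W) :
  f ∘ (g ∘ (h ∘ w)) = x ∘ w.
Proof. by rewrite -e -!compA. Qed.

(** * Morphisms induced by the balancing *)

Section Span.
Variables (k : fieldType) (D : moncat k) (M N : abcat k).
Variables (r : rightact D M) (l : leftact D N).
Implicit Types (m : M) (n : N) (X Y : D).

(** For fixed endpoints, the pairs (u, v) modulo [bal_span_slide] form the coend over Y of Hom(m, m'
    ◁ Y) ⊗ Hom(Y ▷ n, n'), the expected space of morphisms in the relative tensor product. This is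
    its action through F. *)
Definition bal_span (A : lincat k) (F : balanced r l A) m m' n n' Y
    (u : hom m (r m' Y)) (v : hom (l Y n) n') : hom (F m n) (F m' n') :=
  F⟪\id, v⟫ ∘ (bal F m' Y n ∘ F⟪u, \id⟫).

Section Fixed.
Variables (A : lincat k) (F : balanced r l A).

Lemma bal_span_slide m m' n n' Y Y' (u : hom m (r m' Y)) (w : hom Y Y')
    (v : hom (l Y' n) n') :
  bal_span F u (v ∘ l⟪w, \id⟫) = bal_span F (r⟪\id, w⟫ ∘ u) v.
Proof.
by rewrite /bal_span bmap_r bmap_l -!compA (compR (bal_nat _ _ _ _)).
Qed.

(** By [bal_assoc], crossing Y and then Y' is crossing Y' ⊗ Y at once. The new legs do not involve
    F, so a rule that respects spans is automatically compatible with composition. *)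
Lemma bal_span_comp m m' m'' n n' n'' Y Y' (u : hom m (r m' Y)) (v : hom (l Y n) n')
    (u' : hom m' (r m'' Y')) (v' : hom (l Y' n') n'') :
  bal_span F u' v' ∘ bal_span F u v =
  bal_span F (ra_assoc r m'' Y' Y ∘ (r⟪u', \id⟫ ∘ u)) (v' ∘ (l⟪\id, v⟫ ∘ la_assoc l Y' Y n)).
Proof.
rewrite /bal_span !bmap_l !bmap_r -!compA; congr (_ ∘ _).
rewrite (compR (esym (bmap_c F u' v))).
have := bal_nat F (idm m'') (idm Y') v; rewrite bmap1 => E; rewrite (compR E).
have := bal_nat F u' (idm Y) (idm n); rewrite bmap1 => E'; rewrite -(compR E').
congr (_ ∘ _); have := bal_assoc F m'' Y' Y n; rewrite -!compA => E2.
by rewrite !compA; congr (_ ∘ _ ∘ _); rewrite -!compA E2.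
Qed.

(** [balanced] contains no unit axiom; this derives it. The span over 𝟙 is idempotent and
    invertible, hence the identity. *)
Lemma bal_span_unit m n : bal_span F (bwd (ra_unit r m)) (la_unit l n) = \id.
Proof.
set th := bal_span _ _ _.
have idem : th ∘ th = th.
  (* The composite is a span over 𝟙 ⊗ 𝟙; it is slid down to 𝟙, where the left and right unit
     constraints agree. *)
  rewrite /th bal_span_comp la_triangle bal_span_slide; congr (bal_span F _ _).
  rewrite -munit_eq (compR1 (ra_triangle _ _ _)) compA -bmap_l.
  by rewrite bwdK bmap1 comp1m.
pose i := iso_comp (bif_iso F (iso_id m) (la_unit l n))
  (iso_comp (bal F m 𝟙 n) (bif_iso F (iso_inv (ra_unit r m)) (iso_id n))).
by apply: (iso_monic (f := i)); rewrite compm1; apply: idem.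
Qed.

Lemma bal_span_pre m m1 m' n n' Y (u : hom m1 (r m' Y)) (f : hom m m1) (v : hom (l Y n) n') :
  bal_span F (u ∘ f) v = bal_span F u v ∘ F⟪f, \id⟫.
Proof. by rewrite /bal_span bmap_l -!compA. Qed.

Lemma bal_span_post m m' n n1 n' Y (u : hom m (r m' Y)) (v : hom (l Y n) n1) (g : hom n1 n') :
  bal_span F u (g ∘ v) = F⟪\id, g⟫ ∘ bal_span F u v.
Proof. by rewrite /bal_span bmap_r -!compA. Qed.

Lemma bmap_span m m' n n' (f : hom m m') (g : hom n n') :
  bal_span F (bwd (ra_unit r m') ∘ f) (g ∘ la_unit l n) = F⟪f, g⟫.
Proof. by rewrite bal_span_pre bal_span_post bal_span_unit compm1 bmap_rl. Qed.

Lemma bal_spanE m X n : bal_span F (idm (r m X)) (idm (l X n)) = bal F m X n.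
Proof. by rewrite /bal_span !bmap1 comp1m compm1. Qed.

Lemma bal_spanPl m m' n n' Y a (u u' : hom m (r m' Y)) (v : hom (l Y n) n') :
  bal_span F (a *: u + u') v = a *: bal_span F u v + bal_span F u' v.
Proof. by rewrite /bal_span bmapPl !compPr. Qed.

End Fixed.

Lemma bal_span_nat (A : lincat k) (F G : balanced r l A) (t : forall m n, hom (F m n) (G m n))
    m m' n n' Y (u : hom m (r m' Y)) (v : hom (l Y n) n') :
  is_balanced_nat t -> t m' n' ∘ bal_span F u v = bal_span G u v ∘ t m n.
Proof.
move=> [tn tb].
rewrite /bal_span -!compA -(tn _ _ _ _ u (idm n)) (compR (tn _ _ _ _ (idm m') v)).
by rewrite (compR (esym (tb _ _ _))).
Qed.

Lemma bal_span_lf (A A' : lincat k) (K : linfun A A') (F : balanced r l A)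
    m m' n n' Y (u : hom m (r m' Y)) (v : hom (l Y n) n') :
  bal_span (lf_balanced K F) u v = K⟪bal_span F u v⟫.
Proof. by rewrite /bal_span !fmapM. Qed.

End Span.

(** * Retracts and splitting of idempotents *)

Section Retracts.
Variable k : fieldType.

Record retract (C : lincat k) (Z X : C) := Retract {
  rin : hom Z X;
  rout : hom X Z;
  routK : rout ∘ rin = \id
}.

(** The image of e is the kernel of [\id - e]. *)
Lemma split_idempotent (A : abcat k) (X : A) (e : hom X X) :
  e ∘ e = e -> exists (Q : A) (q : retract Q X), rin q ∘ rout q = e.
Proof.
move=> ee; have [_ kers _ _ _] := abP A.
have [Q [i [ei u]]] := kers _ _ (\id - e).
have compB f : (\id - e) ∘ f = f - e ∘ f :> hom Q X.
  by have := compPl (-1) e (idm X) f; rewrite !scaleN1r addrC comp1m => ->; rewrite addrC.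
have compB' f : (\id - e) ∘ f = f - e ∘ f :> hom X X.
  by have := compPl (-1) e (idm X) f; rewrite !scaleN1r addrC comp1m => ->; rewrite addrC.
have e0 : (\id - e) ∘ e = 0 by rewrite compB' ee subrr.
have ei' : e ∘ i = i by apply/esym/eqP; rewrite -subr_eq0 -compB ei.
have [p [ip _]] := u _ e e0.
have pi : p ∘ i = \id.
  have [w [_ uw]] := u _ i ei.
  by rewrite -(uw (p ∘ i)) ?(uw \id) ?compm1 // compA ip.
by exists Q, (Retract pi).
Qed.

End Retracts.

(** * A criterion for universality *)

Section Criterion.
Variables (k : fieldType) (D : moncat k) (M N : abcat k).
Variables (r : rightact D M) (l : leftact D N) (T : abcat k) (B : balanced r l T).
Implicit Types (m : M) (n : N) (X Y : D).

(** H plays the internal Hom from n to n', with evaluation e. The coend of spans then collapses to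
    Hom(m, m' ◁ H), and B is asked to have exactly these morphisms. *)
Definition span_presented := forall n n' : N, exists (H : D) (e : hom (l H n) n'),
  (forall Y (v : hom (l Y n) n'), exists w : hom Y H, e ∘ l⟪w, \id⟫ = v) /\
  (forall m m' (f : hom (B m n) (B m' n')), exists! u : hom m (r m' H), bal_span B u e = f).

Definition dominant := forall Z : T, exists m n, inhabited (retract Z (B m n)).

Hypotheses (pres : span_presented) (dom : dominant).

Lemma span_surj m n m' n' (f : hom (B m n) (B m' n')) :
  exists Y (u : hom m (r m' Y)) (v : hom (l Y n) n'), bal_span B u v = f.
Proof. by have [H [e [_ /(_ _ _ f) [u [uf _]]]]] := pres n n'; exists H, u, e. Qed.

(** Both spans slide to the normal form with right leg e. There, equality in B forces the left legs
    to agree, and the same slides are valid in F. *)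
Lemma span_determined A (F : balanced r l A) m n m' n' Y (u : hom m (r m' Y))
    (v : hom (l Y n) n') Y' (u' : hom m (r m' Y')) (v' : hom (l Y' n) n') :
  bal_span B u v = bal_span B u' v' -> bal_span F u v = bal_span F u' v'.
Proof.
have [H [e [fac bij]]] := pres n n'.
have [w <-] := fac _ v; have [w' <-] := fac _ v'; rewrite !bal_span_slide => E.
have [x [_ ux]] := bij _ _ (bal_span B (r⟪\id, w'⟫ ∘ u') e).
by rewrite -(ux _ E) -(ux _ erefl).
Qed.

Section Extend.
Variables (A : abcat k) (F : balanced r l A).

Definition span_ext (Phi : forall m n m' n', hom (B m n) (B m' n') -> hom (F m n) (F m' n')) :=
  forall m n m' n' Y (u : hom m (r m' Y)) (v : hom (l Y n) n'),
    Phi _ _ _ _ (bal_span B u v) = bal_span F u v.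

Lemma span_ext_exists : exists Phi, span_ext Phi.
Proof.
pose I := {p : M * N * (M * N) & hom (B p.1.1 p.1.2) (B p.2.1 p.2.2)}.
(* One value is required to serve all spans that represent the given morphism; [span_determined]
   makes this possible. *)
pose Q (i : I) (g : hom (F (tag i).1.1 (tag i).1.2) (F (tag i).2.1 (tag i).2.2)) :=
  forall Y (u : hom _ (r _ Y)) (v : hom (l Y _) _), bal_span B u v = tagged i -> bal_span F u v = g.
have [|Phi span_extP] := @dep_choice I _ Q.
  case=> p f; have [Y [u [v uv]]] := span_surj f; exists (bal_span F u v) => Y' u' v' uv'.
  by apply: span_determined; rewrite uv'.
exists (fun m n m' n' f => Phi (existT _ ((m, n), (m', n')) f)) => m n m' n' Y u v.
exact: esym (span_extP (existT _ ((m, n), (m', n')) (bal_span B u v)) Y u v erefl).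
Qed.

Variable Phi : forall m n m' n', hom (B m n) (B m' n') -> hom (F m n) (F m' n').
Hypothesis PhiE : span_ext Phi.

Lemma span_extM m n m' n' m'' n'' (g : hom (B m' n') (B m'' n'')) (f : hom (B m n) (B m' n')) :
  Phi (g ∘ f) = Phi g ∘ Phi f.
Proof.
have [Y [u [v <-]]] := span_surj f; have [Y' [u' [v' <-]]] := span_surj g.
by rewrite bal_span_comp !PhiE bal_span_comp.
Qed.

Lemma span_ext_bmap m n m' n' (f : hom m m') (g : hom n n') : Phi B⟪f, g⟫ = F⟪f, g⟫.
Proof. by rewrite -bmap_span PhiE bmap_span. Qed.

Lemma span_ext1 m n : Phi (idm (B m n)) = \id.
Proof. by rewrite -bmap1 span_ext_bmap bmap1. Qed.

Lemma span_ext_bal m X n : Phi (bal B m X n) = bal F m X n.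
Proof. by rewrite -bal_spanE PhiE bal_spanE. Qed.

(** Spans can be added once they share a leg; the normal form over e gives f and g the same right
    leg. *)
Lemma span_extP m n m' n' a (f g : hom (B m n) (B m' n')) :
  Phi (a *: f + g) = a *: Phi f + Phi g.
Proof.
have [H [e [_ bij]]] := pres n n'.
have [u [<- _]] := bij _ _ f; have [u' [<- _]] := bij _ _ g.
by rewrite -bal_spanPl !PhiE bal_spanPl.
Qed.

(** [cQ] will be the value of the extension at Z: the idempotent that cuts Z out of [B cm cn] is
    sent to A by [Phi] and split there. *)
Record cover (Z : T) := Cover {
  cm : M; cn : N; cr : retract Z (B cm cn);
  cQ : A; cq : retract cQ (F cm cn);
  cqE : rin cq ∘ rout cq = Phi (rin cr ∘ rout cr)
}.

Lemma cover_exists : inhabited (forall Z, cover Z).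
Proof.
have [|c _] := @dep_choice T cover (fun _ _ => True); last by constructor.
move=> Z; have [m [n [q]]] := dom Z.
have [|Q [s sE]] := @split_idempotent k A (F m n) (Phi (rin q ∘ rout q)).
  by rewrite -span_extM -!compA (compR1 (routK q)) comp1m.
by exists (Cover sE).
Qed.

Variable c : forall Z, cover Z.

Definition extension_fun : linfun T A.
Proof.
refine (@LinFun k T A (fun Z => cQ (c Z)) (fun Z Z' f =>
  rout (cq (c Z')) ∘ (Phi (rin (cr (c Z')) ∘ (f ∘ rout (cr (c Z)))) ∘ rin (cq (c Z)))) _ _ _).
- by move=> Z; rewrite comp1m -cqE -compA routK compm1 routK.
- move=> X Y Z g f; rewrite -[RHS]compA -[in RHS]compA (compR1 (cqE _)).
  rewrite !(compR1 (esym (span_extM _ _))) -!compA.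
  by rewrite (compR1 (routK _)) comp1m (compR1 (routK _)) comp1m.
- by move=> X Y a f g; rewrite compPl compPr span_extP compPl compPr.
Defined.

(** The cover chosen for [B m n] may be another object of the form B m1 n1; [Phi] of the retraction
    maps compares the two. *)
Definition extension_iso m n : iso (extension_fun (B m n)) (F m n).
Proof.
refine (@Iso k A _ _ (Phi (rout (cr (c (B m n)))) ∘ rin (cq (c (B m n))))
  (rout (cq (c (B m n))) ∘ Phi (rin (cr (c (B m n))))) _ _).
- by rewrite -compA (compR1 (esym (span_extM _ _))) -cqE -compA routK compm1 routK.
- rewrite -compA (compR1 (cqE _)) -!span_extM.
  by rewrite -!compA routK compm1 routK span_ext1.
Defined.

Lemma extension_iso_nat m n m' n' (f : hom (B m n) (B m' n')) :
  extension_iso m' n' ∘ extension_fun⟪f⟫ = Phi f ∘ extension_iso m n.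
Proof.
rewrite /= -!compA (compR1 (cqE _)).
rewrite !(compR1 (esym (span_extM _ _))) -!compA.
by rewrite (compR1 (routK _)) comp1m (compR1 (routK _)) comp1m.
Qed.

End Extend.

(** For the clause on transformations: all morphisms between objects [B m n] are spans, so a
    balanced transformation is natural for all of them, and a retraction then dictates its value at
    any other object. *)
Lemma span_universal : is_universal B.
Proof.
move=> A; split.
  move=> F; have [Phi PhiE] := span_ext_exists F; have [c] := cover_exists PhiE.
  exists (extension_fun PhiE c), (extension_iso PhiE c); split.
    by move=> m m' n n' f g; rewrite -(span_ext_bmap PhiE) -extension_iso_nat.
  by move=> m X n; rewrite -(span_ext_bal PhiE) -extension_iso_nat.
move=> K L t tn.
have tN m n m' n' (f : hom (B m n) (B m' n')) : t m' n' ∘ K⟪f⟫ = L⟪f⟫ ∘ t m n.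
  by have [Y [u [v <-]]] := span_surj f; rewrite -!bal_span_lf (bal_span_nat _ _ tn).
have [|c _] := @dep_choice T (fun Z => {p : M * N & retract Z (B p.1 p.2)}) (fun _ _ => True).
  by move=> Z; have [m [n [q]]] := dom Z; exists (existT _ (m, n) q).
pose s Z := L⟪rout (tagged (c Z))⟫ ∘ (t _ _ ∘ K⟪rin (tagged (c Z))⟫).
exists s; split.
- move=> X Y f; rewrite /s -!compA -fmapM.
  have -> : rin (tagged (c Y)) ∘ f =
      (rin (tagged (c Y)) ∘ (f ∘ rout (tagged (c X)))) ∘ rin (tagged (c X)).
    by rewrite -!compA routK compm1.
  rewrite [in LHS]fmapM (compR (tN _ _ _ _ _)) !compA -!fmapM; congr (_⟪_⟫ ∘ _ ∘ _).
  by rewrite !compA routK comp1m.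
- by move=> m n; rewrite /s tN compA -fmapM routK fmap1 comp1m.
- move=> s' s'n s't Z.
  by rewrite /s -s't s'n compA -fmapM routK fmap1 comp1m.
Qed.

End Criterion.

(** * Uniqueness of universal balanced bifunctors *)

Section UniversalTheory.
Variables (k : fieldType) (D : moncat k) (M N : abcat k).
Variables (r : rightact D M) (l : leftact D N).

Lemma balanced_nat_comp (A : lincat k) (F G H : balanced r l A)
    (t : forall m n, hom (F m n) (G m n)) (t' : forall m n, hom (G m n) (H m n)) :
  is_balanced_nat t -> is_balanced_nat t' -> is_balanced_nat (fun m n => t' m n ∘ t m n).
Proof.
move=> [tn tb] [tn' tb']; split.
  by move=> m m' n n' f g; rewrite -compA tn (compR (tn' _ _ _ _ _ _)) compA.
by move=> m X n; rewrite (compR (tb' _ _ _)) tb compA.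
Qed.

Lemma balanced_nat_lf (A A' : lincat k) (K : linfun A A') (F G : balanced r l A)
    (t : forall m n, hom (F m n) (G m n)) :
  is_balanced_nat t ->
  @is_balanced_nat k D M N r l A' (lf_balanced K F) (lf_balanced K G) (fun m n => K⟪t m n⟫).
Proof.
by move=> [tn tb]; split=> [m m' n n' f g|m X n] /=; rewrite -!fmapM ?tn ?tb.
Qed.

Lemma balanced_nat_inv (A : lincat k) (F G : balanced r l A)
    (t : forall m n, iso (F m n) (G m n)) :
  is_balanced_nat t -> is_balanced_nat (fun m n => bwd (t m n)).
Proof.
move=> [tn tb]; split=> [m m' n n' f g|m X n]; first by apply: iso_sq; rewrite tn.
by apply: esym; apply: iso_sq; rewrite tb.
Qed.

Variables (T : abcat k) (B : balanced r l T).
Hypothesis univ : is_universal B.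

Lemma universal_ext (A : abcat k) (K L : linfun T A) (s s' : forall x, hom (K x) (L x)) :
  is_natural s -> is_natural s' -> (forall m n, s (B m n) = s' (B m n)) -> forall x, s x = s' x.
Proof.
move=> sn sn' e; have [_ /(_ K L (fun m n => s (B m n)))] := univ A.
case=> [|s0 [_ _ uniq]]; first by split=> [m m' n n' f g|m X n] /=; [exact: sn | exact: esym (sn _ _ _)].
by move=> x; rewrite (uniq s) ?(uniq s').
Qed.

Lemma universal_iso (A : abcat k) (K L : linfun T A) (t : forall m n, iso (K (B m n)) (L (B m n))) :
  @is_balanced_nat k D M N r l A (lf_balanced K B) (lf_balanced L B) t ->
  exists2 s : forall x, iso (K x) (L x), is_natural s & forall m n, s (B m n) = t m n :> hom _ _.
Proof.
move=> tn; have [_ ext] := univ A.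
have [s [sn st _]] := ext K L _ tn.
have [s' [sn' st' _]] := ext L K _ (@balanced_nat_inv A (lf_balanced K B) (lf_balanced L B) t tn).
have ss' : forall x, s' x ∘ s x = \id.
  apply: (@universal_ext A K K (fun x => s' x ∘ s x) (fun x => \id)) => [X Y f|X Y f|m n].
  - by rewrite -compA sn (compR (sn' _ _ _)) compA.
  - by rewrite comp1m compm1.
  - by rewrite st st' fwdK.
have s's : forall x, s x ∘ s' x = \id.
  apply: (@universal_ext A L L (fun x => s x ∘ s' x) (fun x => \id)) => [X Y f|X Y f|m n].
  - by rewrite -compA sn' (compR (sn _ _ _)) compA.
  - by rewrite comp1m compm1.
  - by rewrite st st' bwdK.
by exists (fun x => Iso (ss' x) (s's x)).
Qed.

End UniversalTheory.

(** The inverse is the factorization of B through F; each composite agrees with the identity functor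
    on a universal bifunctor, hence everywhere up to isomorphism. *)
Lemma universal_equivalence (k : fieldType) (D : moncat k) (M N : abcat k)
    (r : rightact D M) (l : leftact D N) (T P : abcat k) (B : balanced r l T)
    (F : balanced r l P) (K : linfun T P) (t : forall m n, iso (K (B m n)) (F m n)) :
  is_universal B -> is_universal F ->
  @is_balanced_nat k D M N r l P (lf_balanced K B) F t -> is_equivalence K.
Proof.
move=> univB univF tn; have [/(_ B) [G [u un]] _] := univF T; exists G; split.
  have [|s sn _] := @universal_iso k D M N r l T B univB T (lf_comp G K) (lf_id T)
    (fun m n => iso_comp (u m n) (lf_iso G (t m n))); last by exists s.
  exact: (@balanced_nat_comp k D M N r l T (lf_balanced (lf_comp G K) B) (lf_balanced G F)
    (lf_balanced (lf_id T) B) _ _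
    (@balanced_nat_lf k D M N r l P T G (lf_balanced K B) F t tn) un).
have [|s sn _] := @universal_iso k D M N r l P F univF P (lf_comp K G) (lf_id P)
    (fun m n => iso_comp (t m n) (lf_iso K (u m n))); last by exists s.
exact: (@balanced_nat_comp k D M N r l P (lf_balanced (lf_comp K G) F) (lf_balanced K B)
    (lf_balanced (lf_id P) F) _ _
    (@balanced_nat_lf k D M N r l T P K (lf_balanced G F) B u un) tn).
Qed.

(** * Bimodule structure on the functor induced by a balanced bimodule bifunctor *)

Section PartialFunctors.
Variables (k : fieldType) (A B C : lincat k) (F : bifun A B C).

Definition bif_r (X : A) : linfun B C.
Proof.
refine (@LinFun k B C (F X) (fun Y Y' g => F⟪idm X, g⟫) _ _ _).
- by move=> Y; rewrite bmap1.
- by move=> *; rewrite bmap_r.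
- by move=> *; rewrite bmapPr.
Defined.

Definition bif_l (Y : B) : linfun A C.
Proof.
refine (@LinFun k A C (fun X => F X Y) (fun X X' f => F⟪f, idm Y⟫) _ _ _).
- by move=> X; rewrite bmap1.
- by move=> *; rewrite bmap_l.
- by move=> *; rewrite bmapPl.
Defined.

Lemma bmap_rK (X : A) (Y Y' : B) (f : iso Y Y') Z (h : hom Z (F X Y')) :
  F⟪\id, f⟫ ∘ (F⟪\id, bwd f⟫ ∘ h) = h.
Proof. by rewrite compA -bmap_r bwdK bmap1 comp1m. Qed.

Lemma bmap_rK' (X : A) (Y Y' : B) (f : iso Y Y') Z (h : hom Z (F X Y)) :
  F⟪\id, bwd f⟫ ∘ (F⟪\id, f⟫ ∘ h) = h.
Proof. by rewrite compA -bmap_r fwdK bmap1 comp1m. Qed.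

Lemma bmap_lK (X X' : A) (Y : B) (f : iso X X') Z (h : hom Z (F X' Y)) :
  F⟪f, \id⟫ ∘ (F⟪bwd f, \id⟫ ∘ h) = h.
Proof. by rewrite compA -bmap_l bwdK bmap1 comp1m. Qed.

End PartialFunctors.

Section InducedStructure.
Variables (k : fieldType) (D : moncat k) (M N T P : bimodcat D).
Variables (B : bimodbalanced M N T) (F : bimodbalanced M N P).
Hypothesis univ : is_universal B.
Variables (K : linfun T P) (t : forall m n, iso (K (B m n)) (F m n)).
Hypothesis tn : @is_balanced_nat k D M N (br M) (bl N) P (lf_balanced K B) F t.
Implicit Types (X Y Z : D) (m : M) (n : N) (p : T).

Lemma comparison_nat m m' n n' (f : hom m m') (g : hom n n') :
  t m' n' ∘ K⟪B⟪f, g⟫⟫ = F⟪f, g⟫ ∘ t m n.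
Proof. by case: tn => + _; apply. Qed.

Lemma comparison_bal m X n : t m (X ▷ n) ∘ K⟪bal B m X n⟫ = bal F m X n ∘ t (m ◁ X) n.
Proof. by case: tn => _ ->. Qed.

Lemma comparison_nat' m m' n n' (f : hom m m') (g : hom n n') :
  bwd (t m' n') ∘ F⟪f, g⟫ = K⟪B⟪f, g⟫⟫ ∘ bwd (t m n).
Proof. by apply: iso_sq; rewrite comparison_nat. Qed.

Lemma comparison_bal' m X n : bwd (t m (X ▷ n)) ∘ bal F m X n = K⟪bal B m X n⟫ ∘ bwd (t (m ◁ X) n).
Proof. by apply: iso_sq; rewrite comparison_bal. Qed.

(** On objects [B m n] the structure is forced: this is the only solution of the equation in
    [is_bimod_factorization]. *)
Definition induced_l_at X m n : iso (K (X ▷ B m n)) (X ▷ K (B m n)) :=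
  locked (iso_comp (bif_iso (bl P) (iso_id X) (iso_inv (t m n)))
    (iso_comp (bb_l F X m n) (iso_comp (t (X ▷ m) n) (lf_iso K (iso_inv (bb_l B X m n)))))).

Definition induced_r_at m n Y : iso (K (B m n ◁ Y)) (K (B m n) ◁ Y) :=
  locked (iso_comp (bif_iso (br P) (iso_inv (t m n)) (iso_id Y))
    (iso_comp (bb_r F m n Y) (iso_comp (t m (n ◁ Y)) (lf_iso K (iso_inv (bb_r B m n Y)))))).

Lemma induced_l_atE X m n :
  induced_l_at X m n ∘ K⟪bb_l B X m n⟫ = (\id ▷▷ bwd (t m n)) ∘ (bb_l F X m n ∘ t (X ▷ m) n).
Proof. by rewrite /induced_l_at -lock /= -!compA -fmapM fwdK fmap1 compm1. Qed.

Lemma induced_r_atE m n Y :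
  induced_r_at m n Y ∘ K⟪bb_r B m n Y⟫ = (bwd (t m n) ◁◁ \id) ∘ (bb_r F m n Y ∘ t m (n ◁ Y)).
Proof. by rewrite /induced_r_at -lock /= -!compA -fmapM fwdK fmap1 compm1. Qed.

Lemma bb_l_epic X m n W (f g : hom (K (X ▷ B m n)) W) :
  f ∘ K⟪bb_l B X m n⟫ = g ∘ K⟪bb_l B X m n⟫ -> f = g.
Proof. exact: (iso_epic (f := lf_iso K (bb_l B X m n))). Qed.

Lemma bb_r_epic m n Y W (f g : hom (K (B m n ◁ Y)) W) :
  f ∘ K⟪bb_r B m n Y⟫ = g ∘ K⟪bb_r B m n Y⟫ -> f = g.
Proof. exact: (iso_epic (f := lf_iso K (bb_r B m n Y))). Qed.

Lemma induced_l_at_nat X m m' n n' (f : hom m m') (g : hom n n') :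
  induced_l_at X m' n' ∘ K⟪\id ▷▷ B⟪f, g⟫⟫ = (\id ▷▷ K⟪B⟪f, g⟫⟫) ∘ induced_l_at X m n.
Proof.
apply: bb_l_epic; rewrite -[LHS]compA -[RHS]compA -fmapM -bb_l_nat fmapM induced_l_atE.
rewrite (compR1 (induced_l_atE _ _ _)) -!compA comparison_nat (compR (bb_l_nat _ _ _ _)).
by rewrite !compA -!bmap_r comparison_nat'.
Qed.

Lemma induced_l_at_bal X m Z n :
  (\id ▷▷ K⟪bal B m Z n⟫) ∘ induced_l_at X (m ◁ Z) n =
  induced_l_at X m (Z ▷ n) ∘ K⟪\id ▷▷ bal B m Z n⟫.
Proof.
apply: bb_l_epic; rewrite -[LHS]compA -[RHS]compA -fmapM induced_l_atE.
(* Precomposing with [bmid] brings both sides to the shape of [bb_l_bal]. *)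
apply: (iso_epic (f := lf_iso K (bif_iso B (bmid X m Z) (iso_id n)))).
rewrite -[RHS]compA -!compA -[lf_iso _ _ : hom _ _]/(K⟪B⟪bmid X m Z, \id⟫⟫) -fmapM -bb_l_bal fmapM.
rewrite (compR1 (induced_l_atE _ _ _)) -!compA comparison_bal (compR (bb_l_bal _ _ _ _ _)).
rewrite comparison_nat -!compA.
by rewrite (compR1 (esym (bmap_r _ _ _ _))) -comparison_bal' bmap_r -!compA.
Qed.

(** For fixed X, both p ↦ K (X ▷ p) and p ↦ X ▷ K p are functors on T, and [induced_l_at] is a
    balanced transformation between their restrictions along B. Universality extends it to all p. *)
Lemma induced_l : exists kl : forall X p, iso (K (X ▷ p)) (X ▷ K p),
  (forall X p p' (h : hom p p'), kl X p' ∘ K⟪\id ▷▷ h⟫ = (\id ▷▷ K⟪h⟫) ∘ kl X p) /\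
  (forall X m n, kl X (B m n) ∘ K⟪bb_l B X m n⟫ =
     (\id ▷▷ bwd (t m n)) ∘ (bb_l F X m n ∘ t (X ▷ m) n)).
Proof.
have [X|kl klP] := @dep_choice D (fun X => forall p, iso (K (X ▷ p)) (X ▷ K p))
  (fun X kl => (forall p p' (h : hom p p'), kl p' ∘ K⟪\id ▷▷ h⟫ = (\id ▷▷ K⟪h⟫) ∘ kl p) /\
  (forall m n, kl (B m n) ∘ K⟪bb_l B X m n⟫ =
     (\id ▷▷ bwd (t m n)) ∘ (bb_l F X m n ∘ t (X ▷ m) n))); last first.
  by exists kl; split=> X; case: (klP X).
have [|s sn st] := @universal_iso k D M N (br M) (bl N) T B univ P
  (lf_comp K (bif_r (bl T) X)) (lf_comp (bif_r (bl P) X) K) (induced_l_at X).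
  by split=> [m m' n n' f g|m Z n]; [apply: induced_l_at_nat | apply: induced_l_at_bal].
exists s; split; first exact: sn.
by move=> m n; rewrite st induced_l_atE.
Qed.

Lemma induced_r_at_nat m m' n n' Y (f : hom m m') (g : hom n n') :
  induced_r_at m' n' Y ∘ K⟪B⟪f, g⟫ ◁◁ \id⟫ = (K⟪B⟪f, g⟫⟫ ◁◁ \id) ∘ induced_r_at m n Y.
Proof.
apply: bb_r_epic; rewrite -[LHS]compA -[RHS]compA -fmapM -bb_r_nat fmapM induced_r_atE.
rewrite (compR1 (induced_r_atE _ _ _)) -!compA comparison_nat (compR (bb_r_nat _ _ _ _)).
by rewrite !compA -!bmap_l comparison_nat'.
Qed.

Lemma induced_r_at_bal m Z n Y :
  (K⟪bal B m Z n⟫ ◁◁ \id) ∘ induced_r_at (m ◁ Z) n Y =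
  induced_r_at m (Z ▷ n) Y ∘ K⟪bal B m Z n ◁◁ \id⟫.
Proof.
apply: bb_r_epic; rewrite -[LHS]compA -[RHS]compA -fmapM induced_r_atE bb_r_bal -compA fmapM.
rewrite (compR1 (induced_r_atE _ _ _)) -!compA fmapM (compR (comparison_nat _ _)) comparison_bal.
rewrite (compR1 (esym (bmap_l _ _ _ _))) -comparison_bal' bmap_l -!compA.
by have := bb_r_bal F m Z n Y; rewrite -[RHS]compA => E; rewrite (compR E) -!compA.
Qed.

Lemma induced_r : exists kr : forall p Y, iso (K (p ◁ Y)) (K p ◁ Y),
  (forall p p' Y (h : hom p p'), kr p' Y ∘ K⟪h ◁◁ \id⟫ = (K⟪h⟫ ◁◁ \id) ∘ kr p Y) /\
  (forall m n Y, kr (B m n) Y ∘ K⟪bb_r B m n Y⟫ =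
     (bwd (t m n) ◁◁ \id) ∘ (bb_r F m n Y ∘ t m (n ◁ Y))).
Proof.
have [Y|kr krP] := @dep_choice D (fun Y => forall p, iso (K (p ◁ Y)) (K p ◁ Y))
  (fun Y kr => (forall p p' (h : hom p p'), kr p' ∘ K⟪h ◁◁ \id⟫ = (K⟪h⟫ ◁◁ \id) ∘ kr p) /\
  (forall m n, kr (B m n) ∘ K⟪bb_r B m n Y⟫ =
     (bwd (t m n) ◁◁ \id) ∘ (bb_r F m n Y ∘ t m (n ◁ Y)))); last first.
  by exists (fun p Y => kr Y p); split=> [p p' Y h|m n Y]; case: (krP Y).
have [|s sn st] := @universal_iso k D M N (br M) (bl N) T B univ P
  (lf_comp K (bif_l (br T) Y)) (lf_comp (bif_l (br P) Y) K) (fun m n => induced_r_at m n Y).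
  by split=> [m m' n n' f g|m Z n]; [apply: induced_r_at_nat | apply: induced_r_at_bal].
exists s; split; first exact: sn.
by move=> m n; rewrite st induced_r_atE.
Qed.

Section Coherence.
Variables (kl : forall X p, iso (K (X ▷ p)) (X ▷ K p)).
Variables (kr : forall p Y, iso (K (p ◁ Y)) (K p ◁ Y)).
Hypothesis kln : forall X p p' (h : hom p p'),
  kl X p' ∘ K⟪\id ▷▷ h⟫ = (\id ▷▷ K⟪h⟫) ∘ kl X p.
Hypothesis krn : forall p p' Y (h : hom p p'),
  kr p' Y ∘ K⟪h ◁◁ \id⟫ = (K⟪h⟫ ◁◁ \id) ∘ kr p Y.
Hypothesis klB : forall X m n, kl X (B m n) ∘ K⟪bb_l B X m n⟫ =
  (\id ▷▷ bwd (t m n)) ∘ (bb_l F X m n ∘ t (X ▷ m) n).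
Hypothesis krB : forall m n Y, kr (B m n) Y ∘ K⟪bb_r B m n Y⟫ =
  (bwd (t m n) ◁◁ \id) ∘ (bb_r F m n Y ∘ t m (n ◁ Y)).

(** Here and in the coherence laws below, both sides are natural in p. By [universal_ext] it is
    enough to compare them at [B m n], where the law follows from the corresponding laws of B and
    F. *)
Lemma induced_kl_nat_l X X' p (f : hom X X') : kl X' p ∘ K⟪f ▷▷ \id⟫ = (f ▷▷ \id) ∘ kl X p.
Proof.
pose s q := kl X' q ∘ K⟪f ▷▷ idm q⟫; pose s' q := (f ▷▷ \id) ∘ kl X q.
apply: (@universal_ext k D M N _ _ T B univ P
  (lf_comp K (bif_r (bl T) X)) (lf_comp (bif_r (bl P) X') K) s s') => [q q' h|q q' h|m n].
- by rewrite /s /= -!compA -fmapM -bmap_c fmapM (compR (kln _ _)).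
- by rewrite /s' /= -!compA kln !compA bmap_c.
rewrite /s /s'; apply: bb_l_epic; rewrite -!compA -fmapM klB.
have := bb_l_nat B f (idm m) (idm n); rewrite bmap1 => <-.
rewrite fmapM (compR1 (klB _ _ _)) -!compA comparison_nat (compR (bb_l_nat _ _ _ _)) bmap1.
by rewrite !compA bmap_c.
Qed.

Lemma induced_kr_nat_r p Y Y' (g : hom Y Y') : kr p Y' ∘ K⟪\id ◁◁ g⟫ = (\id ◁◁ g) ∘ kr p Y.
Proof.
pose s q := kr q Y' ∘ K⟪idm q ◁◁ g⟫; pose s' q := (\id ◁◁ g) ∘ kr q Y.
apply: (@universal_ext k D M N _ _ T B univ P
  (lf_comp K (bif_l (br T) Y)) (lf_comp (bif_l (br P) Y') K) s s') => [q q' h|q q' h|m n].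
- by rewrite /s /= -!compA -fmapM bmap_c fmapM (compR (krn _ _)).
- by rewrite /s' /= -!compA krn !compA bmap_c.
rewrite /s /s'; apply: bb_r_epic; rewrite -!compA -fmapM krB.
have := bb_r_nat B (idm m) (idm n) g; rewrite bmap1 => <-.
rewrite fmapM (compR1 (krB _ _ _)) -!compA comparison_nat (compR (bb_r_nat _ _ _ _)) bmap1.
by rewrite !compA bmap_c.
Qed.

Lemma induced_kl_assoc X Y p : la_assoc (bl P) X Y (K p) ∘ kl (X ⊗ Y) p =
  (\id ▷▷ kl Y p) ∘ kl X (Y ▷ p) ∘ K⟪la_assoc (bl T) X Y p⟫.
Proof.
pose s q := la_assoc (bl P) X Y (K q) ∘ kl (X ⊗ Y) q.
pose s' q := (\id ▷▷ kl Y q) ∘ kl X (Y ▷ q) ∘ K⟪la_assoc (bl T) X Y q⟫.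
apply: (@universal_ext k D M N _ _ T B univ P (lf_comp K (bif_r (bl T) (X ⊗ Y)))
  (lf_comp (bif_r (bl P) X) (lf_comp (bif_r (bl P) Y) K)) s s') => [q q' h|q q' h|m n].
- by rewrite /s /= -!compA kln -(bmap1 tens X Y) (compR (la_assoc_nat _ _ _ _)).
- rewrite /s' /= -!compA -fmapM -(bmap1 tens X Y) la_assoc_nat fmapM.
  by rewrite (compR (kln _ _)) (compR1 (esym (bmap_r _ _ _ _))) kln bmap_r -!compA.
rewrite /s /s'; apply: bb_l_epic; rewrite -!compA klB -fmapM bb_l_assoc -compA fmapM.
rewrite (compR (kln _ _)) (compR1 (esym (bmap_r _ _ _ _))) klB fmapM (compR1 (klB _ _ _)).
rewrite -!compA comparison_nat !bmap_r -!compA bmap_rK.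
rewrite -(bmap1 tens X Y) (compR (la_assoc_nat _ _ _ _)).
by have := bb_l_assoc F X Y m n; rewrite -compA => E; rewrite (compR E) -!compA.
Qed.


Lemma induced_kr_assoc p X Y : kr p (X ⊗ Y) ∘ K⟪ra_assoc (br T) p X Y⟫ =
  ra_assoc (br P) (K p) X Y ∘ (kr p X ◁◁ \id) ∘ kr (p ◁ X) Y.
Proof.
pose s q := kr q (X ⊗ Y) ∘ K⟪ra_assoc (br T) q X Y⟫.
pose s' q := ra_assoc (br P) (K q) X Y ∘ (kr q X ◁◁ \id) ∘ kr (q ◁ X) Y.
apply: (@universal_ext k D M N _ _ T B univ P (lf_comp K (lf_comp (bif_l (br T) Y) (bif_l (br T) X)))
  (lf_comp (bif_l (br P) (X ⊗ Y)) K) s s') => [q q' h|q q' h|m n].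
- by rewrite /s /= -!compA -fmapM ra_assoc_nat bmap1 fmapM (compR (krn _ _)).
- rewrite /s' /= -!compA krn (compR1 (esym (bmap_l _ _ _ _))) krn bmap_l -!compA.
  by rewrite (compR (ra_assoc_nat _ _ _ _)) bmap1.
rewrite /s /s'.
(* [krB] speaks only of objects [B m n]; these two isomorphisms replace [(B m n ◁ X) ◁ Y] by
   [B m ((n ◁ X) ◁ Y)]. *)
apply: (iso_epic (f := lf_iso K (bif_iso (br T) (bb_r B m n X) (iso_id Y)))).
apply: (iso_epic (f := lf_iso K (bb_r B m (n ◁ X) Y))).
rewrite -!compA -[lf_iso _ (bif_iso _ _ _) : hom _ _]/(K⟪bb_r B m n X ◁◁ \id⟫).
rewrite -[lf_iso _ (bb_r _ _ _ _) : hom _ _]/(K⟪bb_r B m (n ◁ X) Y⟫).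
rewrite -!fmapM; have := bb_r_assoc B m n X Y; rewrite -!compA => <-.
rewrite !fmapM (compR1 (krB _ _ _)) -!compA comparison_nat.
have := bb_r_assoc F m n X Y; rewrite -!compA => E; rewrite (compR E).
rewrite (compR (krn _ _)) krB (compR1 (esym (bmap_l _ _ _ _))) krB !bmap_l -!compA.
by rewrite bmap_lK (compR (ra_assoc_nat _ _ _ _)) bmap1.
Qed.

Lemma induced_kl_unit p : la_unit (bl P) (K p) ∘ kl 𝟙 p = K⟪la_unit (bl T) p⟫.
Proof.
pose s q := la_unit (bl P) (K q) ∘ kl 𝟙 q; pose s' q := K⟪la_unit (bl T) q⟫.
apply: (@universal_ext k D M N _ _ T B univ P (lf_comp K (bif_r (bl T) 𝟙)) K s s')
  => [q q' h|q q' h|m n].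
- by rewrite /s /= -!compA kln (compR (la_unit_nat _ _)).
- by rewrite /s' /= -!fmapM la_unit_nat.
rewrite /s /s'; apply: bb_l_epic; rewrite -compA klB -fmapM bb_l_unit (compR (la_unit_nat _ _)).
by rewrite (compR1 (bb_l_unit _ _ _)) -comparison_nat (compA (bwd _)) fwdK comp1m.
Qed.

Lemma induced_kr_unit p : ra_unit (br P) (K p) ∘ kr p 𝟙 = K⟪ra_unit (br T) p⟫.
Proof.
pose s q := ra_unit (br P) (K q) ∘ kr q 𝟙; pose s' q := K⟪ra_unit (br T) q⟫.
apply: (@universal_ext k D M N _ _ T B univ P (lf_comp K (bif_l (br T) 𝟙)) K s s')
  => [q q' h|q q' h|m n].
- by rewrite /s /= -!compA krn (compR (ra_unit_nat _ _)).
- by rewrite /s' /= -!fmapM ra_unit_nat.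
rewrite /s /s'; apply: bb_r_epic; rewrite -compA krB -fmapM bb_r_unit (compR (ra_unit_nat _ _)).
by rewrite (compR1 (bb_r_unit _ _ _)) -comparison_nat (compA (bwd _)) fwdK comp1m.
Qed.

Lemma induced_mid X p Y : (\id ▷▷ kr p Y) ∘ kl X (p ◁ Y) ∘ K⟪bmid X p Y⟫ =
  bmid X (K p) Y ∘ (kl X p ◁◁ \id) ∘ kr (X ▷ p) Y.
Proof.
pose s q := (\id ▷▷ kr q Y) ∘ kl X (q ◁ Y) ∘ K⟪bmid X q Y⟫.
pose s' q := bmid X (K q) Y ∘ (kl X q ◁◁ \id) ∘ kr (X ▷ q) Y.
apply: (@universal_ext k D M N _ _ T B univ P (lf_comp K (lf_comp (bif_l (br T) Y) (bif_r (bl T) X)))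
  (lf_comp (bif_r (bl P) X) (lf_comp (bif_l (br P) Y) K)) s s') => [q q' h|q q' h|m n].
- rewrite /s /= -!compA -fmapM bmid_nat fmapM (compR (kln _ _)).
  by rewrite (compR1 (esym (bmap_r _ _ _ _))) krn bmap_r -!compA.
- rewrite /s' /= -!compA krn (compR1 (esym (bmap_l _ _ _ _))) kln bmap_l -!compA.
  by rewrite (compR (bmid_nat _ _ _)).
rewrite /s /s'.
apply: (iso_epic (f := lf_iso K (bif_iso (br T) (bb_l B X m n) (iso_id Y)))).
apply: (iso_epic (f := lf_iso K (bb_r B (X ▷ m) n Y))).
rewrite -!compA -[lf_iso _ (bif_iso _ _ _) : hom _ _]/(K⟪bb_l B X m n ◁◁ \id⟫).
rewrite -[lf_iso _ (bb_r _ _ _ _) : hom _ _]/(K⟪bb_r B (X ▷ m) n Y⟫).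
rewrite -!fmapM; have := bb_mid B X m n Y; rewrite -!compA => <-.
rewrite !fmapM (compR (kln _ _)) klB (compR1 (esym (bmap_r _ _ (kr _ _) _))) krB.
rewrite (compR (krn _ _)) krB (compR1 (esym (bmap_l _ _ (kl _ _) _))) klB !bmap_l !bmap_r -!compA.
rewrite bmap_rK bmap_lK (compR (bmid_nat _ _ _)).
by have := bb_mid F X m n Y; rewrite -!compA => E; rewrite !compA; congr (_ ∘ _); rewrite -!compA E.
Qed.

Definition induced_struct : bimodfun_struct K.
Proof.
refine (@BimodFunStruct k D T P K kl kr _ _ induced_kl_assoc induced_kr_assoc
  induced_kl_unit induced_kr_unit induced_mid).
- by move=> X X' p p' f h; rewrite -bmap_rl fmapM compA kln -compA induced_kl_nat_l compA bmap_rl.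
- by move=> p p' Y Y' h g; rewrite -bmap_lr fmapM compA krn -compA induced_kr_nat_r compA bmap_lr.
Defined.

End Coherence.

End InducedStructure.

Lemma reltensor_induces (k : fieldType) (D : moncat k) (M N T P : bimodcat D)
    (B : bimodbalanced M N T) (F : bimodbalanced M N P) (K : linfun T P)
    (t : forall m n, iso (K (B m n)) (F m n)) :
  is_universal B -> @is_balanced_nat k D M N (br M) (bl N) P (lf_balanced K B) F t ->
  exists s : bimodfun_struct K,
  (forall X m n, bb_l F X m n ∘ t (X ▷ m) n =
     (\id ▷▷ t m n) ∘ kl s X (B m n) ∘ K⟪bb_l B X m n⟫) /\
  (forall m n Y, bb_r F m n Y ∘ t m (n ◁ Y) =
     (t m n ◁◁ \id) ∘ kr s (B m n) Y ∘ K⟪bb_r B m n Y⟫).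
Proof.
move=> univ tn; have [kl [kln klB]] := induced_l univ tn; have [kr [krn krB]] := induced_r univ tn.
exists (induced_struct univ tn kln krn klB krB); split=> [X m n|m n Y] /=.
  by rewrite -compA klB bmap_rK.
by rewrite -compA krB bmap_lK.
Qed.

Lemma universal_reltensor_equivalent (k : fieldType) (D : rigidcat k) (M N P : bimodcat D)
    (F : bimodbalanced M N P) : is_universal F -> reltensor_equivalent M N P.
Proof.
move=> univF; split; first exact: inhabits (RelTensor univF).
move=> T; have [/(_ F) [K [t tn]] _] := rt_univ T P.
have [s _] := reltensor_induces (rt_univ T) tn.
by exists K; split; [exact: inhabits s | exact: (universal_equivalence (rt_univ T) univF tn)].
Qed.

Lemma universal_induces (k : fieldType) (D : rigidcat k) (M N P : bimodcat D)
    (F : bimodbalanced M N P) : is_universal F -> induces_bimod_equivalence F.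
Proof.
move=> univF; split; first exact: inhabits (RelTensor univF).
move=> T K t tn; split; last exact: (universal_equivalence (rt_univ T) univF tn).
exact: (reltensor_induces (rt_univ T) tn).
Qed.

(** * Universality of the tensor product *)

Section SplitEvaluation.
Variables (k : fieldType) (C : fusioncat k).

Lemma mono_ker0 (X Y : C) (f : hom X Y) : (forall W (g : hom W X), f ∘ g = 0 -> g = 0) -> mono f.
Proof.
move=> f0 W g h /eqP; rewrite -subr_eq0 => /eqP fgh; apply/eqP; rewrite -subr_eq0; apply/eqP.
apply: f0; have := compPr (-1) f h g.
by rewrite !scaleN1r addrC => ->; rewrite addrC.
Qed.

(** Schur's lemma. The kernel of f is zero or all of X, and the latter would give f = 0; so f is
    mono, and simplicity of Y applies to f itself. *)
Lemma simple_nonzero_iso (X Y : C) (f : hom X Y) : simple X -> simple Y -> f <> 0 -> is_iso f.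
Proof.
move=> [_ sX] [_ sY] f0; have [_ kers _ _ _] := abP C.
have [K [m [fm u]]] := kers _ _ f.
have mm : mono m.
  move=> W g h e; have [|w [_ uw]] := u _ (m ∘ g); first by rewrite compA fm comp0m.
  by rewrite -(uw g) ?(uw h).
have [m0|[m' [_ mm']]] := sX _ _ mm; last first.
  by case: f0; rewrite -[f]compm1 -mm' compA fm comp0m.
have fmono : mono f.
  by apply: mono_ker0 => W g /(u _ g) [w [<- _]]; rewrite m0 comp0m.
by case: (sY _ _ fmono).
Qed.

(** Some simple summand of X maps nontrivially to 𝟙, hence isomorphically since 𝟙 is simple; the
    inverse followed by the inclusion is a section. *)
Lemma epi_unit_splits (X : C) (f : hom X 𝟙) : f <> 0 -> exists s : hom 𝟙 X, f ∘ s = \id.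
Proof.
move=> f0; have [ss _ _ s1] := fusP C.
have [n [S [Ss [i [p [_ _ ip]]]]]] := ss X.
have [j fj] : exists j, f ∘ i j != 0.
  case: (pickP (fun j => f ∘ i j != 0)) => [j fj|H]; first by exists j.
  case: f0; rewrite -[f]compm1 -ip.
  have fsum (r : seq 'I_n) : f ∘ (\sum_(j <- r) i j ∘ p j) = 0.
    elim: r => [|j r IH]; first by rewrite big_nil compm0.
    rewrite big_cons; have := compPr 1 f (i j ∘ p j) (\sum_(j <- r) i j ∘ p j).
    rewrite !scale1r IH addr0 => ->; rewrite compA.
    by move/negbFE/eqP: (H j) => ->; rewrite comp0m.
  exact: fsum.
have [g [_ fg]] := simple_nonzero_iso (Ss j) s1 (elimN eqP fj).
by exists (i j ∘ g); rewrite compA.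
Qed.

(** If [lev Y] vanished, the zigzag identity would make [idm Y] zero. *)
Lemma lev_splits (Y : C) : idm Y <> 0 -> exists s : hom 𝟙 (ldual Y ⊗ Y), lev Y ∘ s = \id.
Proof.
move=> Y0; apply: epi_unit_splits => e; apply: Y0.
by rewrite -(lzigzag1 Y) e bmap0r !(compm0, comp0m).
Qed.

Lemma cap_splits (Y Z : C) : idm Y <> 0 -> inhabited (retract Z ((Z ⊗ ldual Y) ⊗ Y)).
Proof.
move=> /lev_splits [s es]; constructor.
apply: (@Retract k C Z _ (bwd (massoc Z (ldual Y) Y) ∘ ((\id ⊗⊗ s) ∘ bwd (mrunit Z))) (cap Y Z)).
rewrite capE -!compA (compR1 (bwdK _)) comp1m (compR1 (esym (bmap_r _ _ _ _))) es bmap1 comp1m.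
by rewrite bwdK.
Qed.

End SplitEvaluation.

Section GradedTensor.
Variables (gT : finGroupType) (k : fieldType) (C : fusioncat k).
Implicit Types E : grading gT C.

Lemma tens_presented E (g h : gT) : span_presented (tens_balanced E g h).
Proof.
move=> n n'.
have dH : deg E 1%g (sval n' ⊗ ldual (sval n)).
  by apply: (deg_eq (mulgV h)); apply: deg_tens (svalP n') (deg_ldual (svalP n)).
exists (exist _ _ dH), (cap (sval n) (sval n')); split=> [Y v|m m' f].
  by exists (curry v); apply: curryK.
(* With right leg [cap], a span is its left leg uncurried, up to associativity. Existence and
   uniqueness of u thus become the adjunction Hom(m ⊗ n, W) = Hom(m, W ⊗ [ldual] n) for W = m' ⊗
   n'. *)
have spanE (u : hom (sval m) (sval m' ⊗ (sval n' ⊗ ldual (sval n)))) :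
    (\id ⊗⊗ cap (sval n) (sval n')) ∘ (massoc _ _ _ ∘ (u ⊗⊗ \id)) =
    cap (sval n) _ ∘ ((bwd (massoc _ _ _) ∘ u) ⊗⊗ \id).
  rewrite cap_tens bmap_l -!compA; congr (_ ∘ (_ ∘ _)).
  by rewrite compA -bmap_l bwdK bmap1 comp1m.
exists (massoc _ _ _ ∘ curry f); split.
  by apply: (etrans (spanE _)); rewrite compA fwdK comp1m curryK.
move=> u; move/(etrans (esym (spanE _))) => uf.
have -> : curry f = bwd (massoc _ _ _) ∘ u by apply: cap_inj; rewrite curryK uf.
by rewrite compA bwdK comp1m.
Qed.

Lemma tens_dominant E (faithful : faithful_grading E) (g h : gT) :
  dominant (tens_balanced E g h).
Proof.
move=> Z; have [Y [dY Y0]] := faithful h.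
have dm : deg E g (sval Z ⊗ ldual Y).
  by apply: (deg_eq (mulgK h g)); apply: deg_tens (svalP Z) (deg_ldual dY).
have [[i p pi]] := cap_splits (sval Z) Y0.
exists (exist _ _ dm), (exist _ _ dY); constructor.
exact: (@Retract k (component E (g * h)%g) Z (tens_balanced E g h (exist _ _ dm) (exist _ _ dY))
  i p pi).
Qed.

Lemma tens_universal E (faithful : faithful_grading E) (g h : gT) :
  is_universal (tens_bimodbalanced E g h).
Proof.
exact: (span_universal (@tens_presented E g h) (@tens_dominant E faithful g h)).
Qed.

End GradedTensor.

(** * Transport along bimodule equivalences *)

Definition fully_faithful (k : fieldType) (A B : lincat k) (R : linfun A B) :=
  forall (X Y : A) (f : hom (R X) (R Y)), exists! g, R⟪g⟫ = f.

Definition ess_surj (k : fieldType) (A B : lincat k) (R : linfun A B) :=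
  forall Y, exists X, inhabited (iso (R X) Y).

Section BimodFunTheory.
Variables (k : fieldType) (D : moncat k) (P Q : bimodcat D) (K : linfun P Q).
Variable s : bimodfun_struct K.
Implicit Types (X Y : D) (p : P).

Lemma kl_nat' X X' p p' (f : hom X X') (h : hom p p') :
  bwd (kl s X' p') ∘ (f ▷▷ K⟪h⟫) = K⟪f ▷▷ h⟫ ∘ bwd (kl s X p).
Proof. by apply: iso_sq; rewrite kl_nat. Qed.

(** The form needed for [pullback_bal], in which the left structure of S enters inverted. *)
Lemma kl_assoc' X Y p :
  bwd (kl s X (Y ▷ p)) ∘ ((\id ▷▷ bwd (kl s Y p)) ∘ la_assoc (bl Q) X Y (K p)) =
  K⟪la_assoc (bl P) X Y p⟫ ∘ bwd (kl s (X ⊗ Y) p).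
Proof.
apply: (iso_epic (f := kl s (X ⊗ Y) p)); rewrite -!compA fwdK compm1 kl_assoc -!compA.
by rewrite bmap_rK' (compR1 (fwdK _)) comp1m.
Qed.

(** [k_mid] solved for the inverse of [bmid], which is how [bmid] occurs in [bb_r_bal]. *)
Lemma k_mid' X p Y :
  kr s (X ▷ p) Y ∘ (K⟪bwd (bmid X p Y)⟫ ∘ bwd (kl s X (p ◁ Y))) =
  (bwd (kl s X p) ◁◁ \id) ∘ (bwd (bmid X (K p) Y) ∘ (\id ▷▷ kr s p Y)).
Proof.
apply: (iso_monic (f := bif_iso (br Q) (kl s X p) (iso_id Y))); rewrite /= bmap_lK.
apply: (iso_monic (f := bmid X (K p) Y)); rewrite (compR1 (bwdK _)) comp1m.
have := k_mid s X p Y; rewrite -!compA => E; rewrite (compA _ (kr s _ _ : hom _ _)) -(compR E) -!compA.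
by rewrite (compR1 (esym (fmapM K _ _))) bwdK fmap1 comp1m bwdK compm1.
Qed.

End BimodFunTheory.

Section BimodFunComp.
Variables (k : fieldType) (D : moncat k).

Definition bimodfun_id (P : bimodcat D) : bimodfun_struct (lf_id P).
Proof.
by refine (@BimodFunStruct k D P P (lf_id P) (fun X p => iso_id (X ▷ p)) (fun p Y => iso_id (p ◁ Y))
  _ _ _ _ _ _ _) => *; rewrite /= ?bmap1 ?comp1m ?compm1.
Defined.

Definition bimodfun_comp (P Q S : bimodcat D) (K : linfun P Q) (L : linfun Q S)
  (sK : bimodfun_struct K) (sL : bimodfun_struct L) : bimodfun_struct (lf_comp L K).
Proof.
refine (@BimodFunStruct k D P S (lf_comp L K)
  (fun X p => iso_comp (kl sL X (K p)) (lf_iso L (kl sK X p)))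
  (fun p Y => iso_comp (kr sL (K p) Y) (lf_iso L (kr sK p Y))) _ _ _ _ _ _ _) => /=.
- by move=> *; rewrite -!compA -fmapM kl_nat fmapM (compR (kl_nat _ _ _)).
- by move=> *; rewrite -!compA -fmapM kr_nat fmapM (compR (kr_nat _ _ _)).
- move=> X Y p; rewrite compA kl_assoc -!compA -!fmapM kl_assoc !fmapM.
  by rewrite bmap_r -!compA (compR (kl_nat _ _ _)).
- move=> p X Y; rewrite -!compA -!fmapM kr_assoc !fmapM -!compA (compR (kr_assoc _ _ _ _)).
  by rewrite -!compA (compR (kr_nat _ _ _)) bmap_l -!compA.
- by move=> p; rewrite compA kl_unit -fmapM kl_unit.
- by move=> p; rewrite compA kr_unit -fmapM kr_unit.
- move=> X p Y; rewrite bmap_r -!compA (compR (esym (kl_nat _ _ _))) -!fmapM.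
  have := k_mid sK X p Y; rewrite -!compA => ->.
  rewrite !fmapM; have := k_mid sL X (K p) Y; rewrite -!compA => E.
  by rewrite !compA -[_ ∘ L⟪bmid _ _ _⟫]compA E -!compA (compR (kr_nat _ _ _)) bmap_l -!compA.
Defined.

Lemma naturally_iso_trans (A B : lincat k) (F G H : linfun A B) :
  naturally_iso F G -> naturally_iso G H -> naturally_iso F H.
Proof.
move=> [t tn] [t' tn']; exists (fun X => iso_comp (t' X) (t X)) => X Y f /=.
by rewrite -compA tn (compR (tn' _ _ _)) compA.
Qed.

Lemma naturally_iso_comp (A B C E : lincat k) (F G : linfun A B) (H : linfun B C) (J : linfun E A) :
  naturally_iso F G -> naturally_iso (lf_comp H (lf_comp F J)) (lf_comp H (lf_comp G J)).
Proof.
by move=> [t tn]; exists (fun X => lf_iso H (t (J X))) => X Y f /=; rewrite -!fmapM tn.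
Qed.

Lemma is_equivalence_comp (A B C : lincat k) (F : linfun A B) (G : linfun B C) :
  is_equivalence F -> is_equivalence G -> is_equivalence (lf_comp G F).
Proof.
move=> [F' [F'F FF']] [G' [G'G GG']]; exists (lf_comp F' G'); split.
  exact: naturally_iso_trans (naturally_iso_comp F' F G'G) F'F.
exact: naturally_iso_trans (naturally_iso_comp G G' FF') GG'.
Qed.

Lemma bimod_equivalent_trans (P Q S : bimodcat D) :
  bimod_equivalent P Q -> bimod_equivalent Q S -> bimod_equivalent P S.
Proof.
move=> [K [[sK] eK]] [L [[sL] eL]]; exists (lf_comp L K).
by split; [constructor; exact: bimodfun_comp | exact: is_equivalence_comp].
Qed.

End BimodFunComp.

Section Pullback.
Variables (k : fieldType) (D : moncat k) (M N M' N' P : bimodcat D).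
Variables (B : bimodbalanced M N P).
Variables (R : linfun M' M) (S : linfun N' N) (sR : bimodfun_struct R) (sS : bimodfun_struct S).

Definition pullback_bifun : bifun M' N' P.
Proof.
refine (@Bifun k M' N' P (fun m n => B (R m) (S n)) (fun m m' n n' f g => B⟪R⟪f⟫, S⟪g⟫⟫) _ _ _ _).
- by move=> *; rewrite !fmap1 bmap1.
- by move=> *; rewrite !fmapM bmapM.
- by move=> *; rewrite fmapP bmapPl.
- by move=> *; rewrite fmapP bmapPr.
Defined.

Definition pullback_bal (m : M') X (n : N') : iso (B (R (m ◁ X)) (S n)) (B (R m) (S (X ▷ n))) :=
  iso_comp (bif_iso B (iso_id (R m)) (iso_inv (kl sS X n)))
    (iso_comp (bal B (R m) X (S n)) (bif_iso B (kr sR m X) (iso_id (S n)))).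

Lemma bal_natl (m : M) m' (f : hom m m') X (n : N) :
  B⟪f, \id⟫ ∘ bal B m X n = bal B m' X n ∘ B⟪f ◁◁ \id, \id⟫.
Proof. by rewrite bal_nat bmap1. Qed.

Lemma bal_natr (m : M) X (n n' : N) (g : hom n n') :
  bal B m X n' ∘ B⟪\id, g⟫ = B⟪\id, \id ▷▷ g⟫ ∘ bal B m X n.
Proof. by rewrite -bal_nat bmap1. Qed.

Definition pullback_balanced : balanced (br M') (bl N') P.
Proof.
refine (@Balanced k D M' N' (br M') (bl N') P pullback_bifun pullback_bal _ _) => /=.
- move=> m m' X X' n n' h f h'.
  rewrite -[LHS]compA -[in LHS](compA (bal _ _ _ _ : hom _ _)) -bmapM kr_nat comp1m.
  rewrite -[S⟪h'⟫]compm1 bmapM (compR (bal_nat _ _ _ _)) !compA; congr (_ ∘ _ ∘ _).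
  by rewrite -!bmapM kl_nat' comp1m compm1.
- move=> m X Y n; rewrite -!compA (compR (esym (bmap_c _ _ _))) (compR (bal_natr _ _ _)).
  rewrite (compR (bal_natl _ _ _)); have := bal_assoc B (R m) X Y (S n); rewrite -!compA => E.
  rewrite (compA _ (bal _ (R m ◁ X) _ _ : hom _ _)) E -!compA.
  have := kr_assoc sR m X Y; rewrite -!compA => E2; rewrite !fmap1 -!bmap_l -E2.
  by rewrite (compR1 (esym (bmap_r _ _ (S⟪_⟫) _))) -kl_assoc' !bmap_r -!compA.
Defined.

Definition pullback_l X (m : M') (n : N') :
  iso (pullback_balanced (X ▷ m) n) (X ▷ pullback_balanced m n) :=
  iso_comp (bb_l B X (R m) (S n)) (bif_iso B (kl sR X m) (iso_id (S n))).

Definition pullback_r (m : M') (n : N') Y :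
  iso (pullback_balanced m (n ◁ Y)) (pullback_balanced m n ◁ Y) :=
  iso_comp (bb_r B (R m) (S n) Y) (bif_iso B (iso_id (R m)) (kr sS n Y)).

Lemma bb_l_nat1 X (m m' : M) (n n' : N) (f : hom m m') (g : hom n n') :
  bb_l B X m' n' ∘ B⟪\id ▷▷ f, g⟫ = (\id ▷▷ B⟪f, g⟫) ∘ bb_l B X m n.
Proof. exact: bb_l_nat. Qed.

Lemma bb_r_nat1 Y (m m' : M) (n n' : N) (f : hom m m') (g : hom n n') :
  bb_r B m' n' Y ∘ B⟪f, g ◁◁ \id⟫ = (B⟪f, g⟫ ◁◁ \id) ∘ bb_r B m n Y.
Proof. exact: bb_r_nat. Qed.

Lemma bb_l_natr X (m : M) (n n' : N) (g : hom n n') :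
  bb_l B X m n' ∘ B⟪\id, g⟫ = (\id ▷▷ B⟪\id, g⟫) ∘ bb_l B X m n.
Proof. by rewrite -bb_l_nat1 bmap1. Qed.

Lemma bb_r_natl Y (m m' : M) (n : N) (f : hom m m') :
  bb_r B m' n Y ∘ B⟪f, \id⟫ = (B⟪f, \id⟫ ◁◁ \id) ∘ bb_r B m n Y.
Proof. by rewrite -bb_r_nat1 bmap1. Qed.

Definition pullback_bimodbalanced : bimodbalanced M' N' P.
Proof.
refine (@BimodBalanced k D M' N' P pullback_balanced pullback_l pullback_r
  _ _ _ _ _ _ _ _ _) => /=.
- move=> X X' m m' n n' f h h'.
  rewrite -[LHS]compA -bmapM kl_nat comp1m -[S⟪h'⟫ in LHS]compm1 bmapM.
  by rewrite (compR (bb_l_nat _ _ _ _)).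
- move=> m m' n n' Y Y' h h' g.
  rewrite -[LHS]compA -bmapM kr_nat comp1m -[R⟪h⟫ in LHS]compm1 bmapM.
  by rewrite (compR (bb_r_nat _ _ _ _)).
- move=> X Y m n; rewrite compA bb_l_assoc fmap1 -!compA -bmap_l kl_assoc -compA !bmap_l bmap_r.
  by rewrite -!compA (compR (bb_l_nat1 _ _ _)).
- move=> m n X Y; rewrite fmap1 -!compA -bmap_r kr_assoc -!compA !bmap_r.
  rewrite (compR (bb_r_assoc _ _ _ _ _)) -!compA.
  by rewrite (compR (bb_r_nat1 _ _ _)) bmap_l -!compA.
- by move=> m n; rewrite compA bb_l_unit fmap1 -bmap_l kl_unit.
- by move=> m n; rewrite compA bb_r_unit fmap1 -bmap_r kr_unit.
- move=> X m Z n; rewrite !fmap1 -!compA (compR (esym (bmap_c _ _ _))) (compR (bal_natl _ _ _)).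
  rewrite (compR (bb_l_natr _ _ _)).
  have E := bb_l_bal B X (R m) Z (S n); rewrite (compR E) -!compA.
  rewrite -!bmap_l; have := k_mid sR X m Z; rewrite -!compA => <-.
  by rewrite !bmap_l (compR (bb_l_nat1 _ _ _)) !bmap_r -!compA.
- move=> m Z n Y; rewrite !fmap1 !bmap_l -!compA (compR (esym (bb_r_natl _ _ _))) bmap_lr.
  rewrite -[B⟪kr sR m Z, _⟫]bmap_rl.
  have E := bb_r_bal B (R m) Z (S n) Y; rewrite -[RHS]compA in E; rewrite (compR E) -!compA.
  rewrite (compR (bal_natr _ _ _)) (compR (esym (bb_r_nat1 _ _ _))).
  rewrite (compR1 (esym (bmap_r _ _ (bwd (bmid _ _ _)) _))) (compR1 (esym (bmap_r _ _ (_ ◁◁ _) _))).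
  by rewrite -k_mid' !bmap_r -!compA.
- move=> X m n Y; rewrite !bmap_l !bmap_r -!compA (compR (esym (bb_l_natr _ _ _))).
  rewrite (compR (esym (bb_r_natl _ _ _))) bmap_rl bmap_lr.
  by have E := bb_mid B X (R m) (S n) Y; rewrite (compR E) -!compA.
Defined.

End Pullback.

Lemma fully_faithful_inj (k : fieldType) (A B : lincat k) (R : linfun A B) (X Y : A) (f g : hom X Y) :
  fully_faithful R -> R⟪f⟫ = R⟪g⟫ -> f = g.
Proof. by move=> ffR e; have [h [_ u]] := ffR _ _ R⟪f⟫; rewrite -(u f) ?(u g). Qed.

Section PullbackUniversal.
Variables (k : fieldType) (D : moncat k) (M N M' N' P : bimodcat D).
Variables (B : bimodbalanced M N P).
Variables (R : linfun M' M) (S : linfun N' N) (sR : bimodfun_struct R) (sS : bimodfun_struct S).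
Hypotheses (ffR : fully_faithful R) (ffS : fully_faithful S).
Let B' := pullback_bimodbalanced B sR sS.

Lemma pullback_span (m m' : M') (n n' : N') (H : D) (u : hom m (m' ◁ H)) (v : hom (H ▷ n) n')
    (e : hom (H ▷ S n) (S n')) :
  S⟪v⟫ = e ∘ kl sS H n -> bal_span B' u v = bal_span B (kr sR m' H ∘ R⟪u⟫) e.
Proof.
move=> ve; rewrite /bal_span /= !fmap1 ve bmap_l bmap_r -!compA bmap_rK.
by [].
Qed.

(** H is kept. Full faithfulness of S lifts the evaluation e, and that of R lifts the left legs. *)
Lemma pullback_presented : span_presented B -> span_presented B'.
Proof.
move=> pres n n'; have [H [e [fac bij]]] := pres (S n) (S n').
have [e' [e'E _]] := ffS (e ∘ kl sS H n); exists H, e'; split=> [Y v|m m' f].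
  have [w we] := fac Y (S⟪v⟫ ∘ bwd (kl sS Y n)); exists w; apply: (fully_faithful_inj ffS).
  by rewrite fmapM e'E -compA kl_nat fmap1 compA we -compA fwdK compm1.
have [u [uf uu]] := bij (R m) (R m') f; have [u' [u'E _]] := ffR (bwd (kr sR m' H) ∘ u).
exists u'; split; first by rewrite (pullback_span _ e'E) u'E (compR1 (bwdK _)) comp1m.
move=> x; rewrite (pullback_span _ e'E) => /uu ux; apply: (fully_faithful_inj ffR).
by rewrite u'E ux (compR1 (fwdK _)) comp1m.
Qed.

Lemma pullback_dominant : ess_surj R -> ess_surj S -> dominant B -> dominant B'.
Proof.
move=> esR esS dom Z; have [m [n [[i p pi]]]] := dom Z.
have [m' [a]] := esR m; have [n' [b]] := esS n; exists m', n'; constructor.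
apply: (@Retract k P Z (B' m' n') (bwd (bif_iso B a b) ∘ i) (p ∘ bif_iso B a b)).
by rewrite -compA (compR1 (bwdK _)) comp1m.
Qed.

Lemma pullback_universal : ess_surj R -> ess_surj S -> span_presented B -> dominant B ->
  is_universal B'.
Proof.
move=> esR esS pres dom.
exact: (span_universal (pullback_presented pres) (pullback_dominant esR esS dom)).
Qed.

End PullbackUniversal.

(** * Quasi-inverse of a bimodule equivalence *)

Section QuasiInverse.
Variables (k : fieldType) (D : moncat k) (P Q : bimodcat D) (L : linfun P Q).
Variable s : bimodfun_struct L.
Variables (q : Q -> P) (eps : forall Y, iso (L (q Y)) Y).
Variable linv : forall X Y, hom (L X) (L Y) -> hom X Y.
Hypotheses (linvK : forall X Y (f : hom (L X) (L Y)), L⟪linv f⟫ = f).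
Hypothesis Linj : forall X Y (f g : hom X Y), L⟪f⟫ = L⟪g⟫ -> f = g.

Definition linv_iso X Y (f : iso (L X) (L Y)) : iso X Y.
Proof.
refine (@Iso k P X Y (linv f) (linv (bwd f)) _ _); apply: Linj; rewrite fmapM !linvK fmap1.
- exact: fwdK.
- exact: bwdK.
Defined.

Definition qinv : linfun Q P.
Proof.
refine (@LinFun k Q P q (fun X Y f => linv (bwd (eps Y) ∘ (f ∘ eps X))) _ _ _).
- by move=> X; apply: Linj; rewrite linvK fmap1 comp1m fwdK.
- move=> X Y Z g f; apply: Linj; rewrite fmapM !linvK -!compA.
  by rewrite (compR1 (bwdK _)) comp1m.
- by move=> X Y a f g; apply: Linj; rewrite fmapP !linvK compPl compPr.
Defined.

Lemma eps_nat X Y (f : hom X Y) : eps Y ∘ L⟪qinv⟪f⟫⟫ = f ∘ eps X.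
Proof. by rewrite linvK (compR1 (bwdK _)) comp1m. Qed.

(** Chosen so that [eps] becomes a transformation of bimodule functors ([qinv_lE], [qinv_rE]). The
    axioms of [qinv_struct] are then checked after applying the faithful L and composing with
    [eps]. *)
Definition qinv_l X p : iso (qinv (X ▷ p)) (X ▷ qinv p) :=
  locked (linv_iso (iso_comp (iso_inv (kl s X (q p)))
    (iso_comp (bif_iso (bl Q) (iso_id X) (iso_inv (eps p))) (eps (X ▷ p))))).

Definition qinv_r p Y : iso (qinv (p ◁ Y)) (qinv p ◁ Y) :=
  locked (linv_iso (iso_comp (iso_inv (kr s (q p) Y))
    (iso_comp (bif_iso (br Q) (iso_inv (eps p)) (iso_id Y)) (eps (p ◁ Y))))).

Lemma qinv_lE X p : (\id ▷▷ eps p) ∘ (kl s X (qinv p) ∘ L⟪qinv_l X p⟫) = eps (X ▷ p).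
Proof. by rewrite /qinv_l -lock /= linvK (compR1 (bwdK _)) comp1m bmap_rK. Qed.

Lemma qinv_rE p Y : (eps p ◁◁ \id) ∘ (kr s (qinv p) Y ∘ L⟪qinv_r p Y⟫) = eps (p ◁ Y).
Proof. by rewrite /qinv_r -lock /= linvK (compR1 (bwdK _)) comp1m bmap_lK. Qed.

Lemma qinv_l_inj X p W (a b : hom W (X ▷ qinv p)) :
  (\id ▷▷ eps p) ∘ (kl s X (qinv p) ∘ L⟪a⟫) = (\id ▷▷ eps p) ∘ (kl s X (qinv p) ∘ L⟪b⟫) -> a = b.
Proof.
move=> e; apply: Linj; apply: (iso_monic (f := kl s X (qinv p))).
exact: (iso_monic (f := bif_iso (bl Q) (iso_id X) (eps p))) e.
Qed.

Lemma qinv_r_inj p Y W (a b : hom W (qinv p ◁ Y)) :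
  (eps p ◁◁ \id) ∘ (kr s (qinv p) Y ∘ L⟪a⟫) = (eps p ◁◁ \id) ∘ (kr s (qinv p) Y ∘ L⟪b⟫) -> a = b.
Proof.
move=> e; apply: Linj; apply: (iso_monic (f := kr s (qinv p) Y)).
exact: (iso_monic (f := bif_iso (br Q) (eps p) (iso_id Y))) e.
Qed.

Lemma qinv_lER X p W (h : hom W _) :
  (\id ▷▷ eps p) ∘ (kl s X (qinv p) ∘ (L⟪qinv_l X p⟫ ∘ h)) = eps (X ▷ p) ∘ h.
Proof. by rewrite -qinv_lE -!compA. Qed.

Lemma qinv_rER p Y W (h : hom W _) :
  (eps p ◁◁ \id) ∘ (kr s (qinv p) Y ∘ (L⟪qinv_r p Y⟫ ∘ h)) = eps (p ◁ Y) ∘ h.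
Proof. by rewrite -qinv_rE -!compA. Qed.

Definition qinv_struct : bimodfun_struct qinv.
Proof.
refine (@BimodFunStruct k D Q P qinv qinv_l qinv_r _ _ _ _ _ _ _).
- move=> X X' p p' f h; apply: qinv_l_inj; rewrite !fmapM qinv_lER eps_nat.
  rewrite (compR (kl_nat _ _ _)) -qinv_lE.
  by rewrite !compA -!bmapM -eps_nat comp1m compm1.
- move=> p p' Y Y' h g; apply: qinv_r_inj; rewrite !fmapM qinv_rER eps_nat.
  rewrite (compR (kr_nat _ _ _)) -qinv_rE.
  by rewrite !compA -!bmapM -eps_nat comp1m compm1.
- move=> X Y p.
  apply: Linj; apply: (iso_monic (f := kl s X (Y ▷ qinv p))).
  apply: (iso_monic (f := bif_iso (bl Q) (iso_id X) (kl s Y (qinv p)))).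
  apply: (iso_monic (f := bif_iso (bl Q) (iso_id X) (bif_iso (bl Q) (iso_id Y) (eps p)))).
  rewrite !fmapM -!compA; have A := kl_assoc s X Y (qinv p); rewrite -[RHS]compA in A.
  rewrite /= [in LHS](compR2 (esym A)) -!compA.
  rewrite -(compR (la_assoc_nat (bl Q) \id \id (eps p))) bmap1 qinv_lE.
  rewrite (compR (kl_nat _ _ _)) !(compR1 (esym (bmap_r _ _ _ _))) -!compA qinv_lE.
  by rewrite qinv_lER eps_nat.
- move=> p X Y.
  apply: Linj; apply: (iso_monic (f := kr s (qinv p) (X ⊗ Y))).
  apply: (iso_monic (f := bif_iso (br Q) (eps p) (iso_id (X ⊗ Y)))).
  rewrite !fmapM -!compA /= qinv_rER eps_nat.
  have A := kr_assoc s (qinv p) X Y; rewrite -[RHS]compA in A.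
  rewrite (compR A) -!compA (compR (kr_nat _ _ _)) -(bmap1 tens X Y).
  rewrite -(compR (ra_assoc_nat (br Q) (eps p) \id \id)).
  by rewrite !(compR1 (esym (bmap_l _ _ _ _))) qinv_rE qinv_rE.
- move=> p; apply: Linj; apply: (iso_monic (f := eps p)).
  by rewrite eps_nat fmapM -(kl_unit s) -!compA -(compR (la_unit_nat _ _)) qinv_lE.
- move=> p; apply: Linj; apply: (iso_monic (f := eps p)).
  by rewrite eps_nat fmapM -(kr_unit s) -!compA -(compR (ra_unit_nat _ _)) qinv_rE.
- move=> X p Y.
  apply: Linj; apply: (iso_monic (f := kl s X (qinv p ◁ Y))).
  apply: (iso_monic (f := bif_iso (bl Q) (iso_id X) (kr s (qinv p) Y))).
  apply: (iso_monic (f := bif_iso (bl Q) (iso_id X) (bif_iso (br Q) (eps p) (iso_id Y)))).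
  rewrite !fmapM -!compA /= (compR (kl_nat _ _ _)).
  have A := k_mid s X (q p) Y; rewrite -!compA in A.
  rewrite [in RHS](compR2 A) -!compA -(compR (bmid_nat \id (eps p) \id)).
  rewrite (compR (kr_nat _ _ _)) !(compR1 (esym (bmap_l _ _ _ _))) -!compA.
  rewrite !(compR1 (esym (bmap_r _ _ _ _))) -!compA.
  by rewrite qinv_lE !qinv_rE qinv_lER eps_nat.
Defined.

End QuasiInverse.

(** Meant for left duality: its bimodule structure is simply [ldual_tens], but it runs into the
    opposite bimodule, whereas the pullback of ⊗ requires a functor out of it. Using right duality
    directly would require identifying [rdual (ldual X)] with X coherently. *)
Lemma quasi_inverse_bimodfun (k : fieldType) (D : moncat k) (P Q : bimodcat D) (L : linfun P Q)
    (s : bimodfun_struct L) : fully_faithful L -> ess_surj L ->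
  exists (R : linfun Q P) (_ : bimodfun_struct R), fully_faithful R /\ ess_surj R.
Proof.
move=> ffL esL.
have [Y|q0 _] := @dep_choice Q (fun Y => {X : P & iso (L X) Y}) (fun _ _ => True).
  by have [X [i]] := esL Y; exists (existT _ X i).
pose q Y := tag (q0 Y); pose eps Y : iso (L (q Y)) Y := tagged (q0 Y).
have [[[X Y] f]|li liK] := @dep_choice {p : P * P & hom (L p.1) (L p.2)}
    (fun i => hom (tag i).1 (tag i).2) (fun i g => L⟪g⟫ = tagged i).
  by have [g [gf _]] := ffL _ _ f; exists g.
pose linv X Y f := li (existT (fun p : P * P => hom (L p.1) (L p.2)) (X, Y) f).
have linvK X Y (f : hom (L X) (L Y)) : L⟪linv X Y f⟫ = f by exact: liK.
have Linj X Y (f g : hom X Y) : L⟪f⟫ = L⟪g⟫ -> f = g by exact: fully_faithful_inj.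
exists (qinv eps linvK Linj), (qinv_struct s eps linvK Linj); split=> [X Y f|X].
  exists (eps Y ∘ (L⟪f⟫ ∘ bwd (eps X))); split.
    apply: (Linj); rewrite linvK -!compA fwdK compm1 (compR1 (fwdK _)) comp1m.
    by [].
  move=> g gf; have := eps_nat eps linvK Linj g; rewrite gf => E.
  by rewrite compA E -compA bwdK compm1.
by exists (L X); constructor; exact: (linv_iso linvK Linj (eps (L X))).
Qed.

(** * Duality and the opposite bimodule *)

Section DualPair.
Variables (k : fieldType) (C : rigidcat k) (A B : C).
Variables (ev : hom (A ⊗ B) 𝟙) (coev : hom 𝟙 (B ⊗ A)).
Hypothesis zigB :
  mrunit B ∘ (\id ⊗⊗ ev) ∘ massoc B A B ∘ (coev ⊗⊗ \id) ∘ bwd (mlunit B) = \id.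
Hypothesis zigA :
  mlunit A ∘ (ev ⊗⊗ \id) ∘ bwd (massoc A B A) ∘ (\id ⊗⊗ coev) ∘ bwd (mrunit A) = \id.
Implicit Types X : C.

(** The mate of p. The pair (A, B) is kept abstract so that it covers both ([ldual Y], Y) and (X,
    [rdual X]). *)
Definition transpose X (p : hom (A ⊗ X) 𝟙) : hom X B :=
  mrunit B ∘ ((\id ⊗⊗ p) ∘ (massoc B A X ∘ ((coev ⊗⊗ \id) ∘ bwd (mlunit X)))).

Lemma transposeK X (f : hom X B) : transpose (ev ∘ (\id ⊗⊗ f)) = f.
Proof.
rewrite -[RHS]comp1m -zigB /transpose -!compA (iso_sq (mlunit_nat f)).
rewrite (compR (esym (bmap_c _ _ _))) -(bmap1 tens B A) (compR (massoc_nat _ _ _)).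
by rewrite (compR1 (esym (bmap_r _ _ _ _))).
Qed.

Lemma ev_transpose X (p : hom (A ⊗ X) 𝟙) : ev ∘ (\id ⊗⊗ transpose p) = p.
Proof.
have run : \id ⊗⊗ mrunit B = mrunit (A ⊗ B) ∘ bwd (massoc A B 𝟙).
  by rewrite mrunit_tens -compA bwdK compm1.
have lun : bwd (massoc A 𝟙 X) ∘ (\id ⊗⊗ bwd (mlunit X)) = bwd (mrunit A) ⊗⊗ \id.
  apply: (iso_monic (f := bif_iso tens (mrunit A) (iso_id X))) => /=.
  by rewrite -bmap_l -triangle -compA (compR1 (bwdK _)) comp1m -bmap_r !bwdK !bmap1.
have mid : \id ⊗⊗ (coev ⊗⊗ \id) =
    massoc A (B ⊗ A) X ∘ (((\id ⊗⊗ coev) ⊗⊗ \id) ∘ bwd (massoc A 𝟙 X)).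
  by rewrite (compR (massoc_nat _ _ _)) bwdK compm1.
rewrite /transpose !bmap_r run -!compA (compR (massoc_nat' _ _ _)) bmap1.
rewrite (compR (esym (mrunit_nat _))) (compR (esym (bmap_c _ _ _))).
rewrite -munit_eq (compR (mlunit_nat _)) -[RHS]compm1; congr (_ ∘ _).
rewrite mid -!compA lun (compR2 (esym (pentagon1 _ _ _ _))) -!compA.
rewrite -(bmap1 tens A X) -(compR (massoc_nat _ _ _)) (compR1 (mlunit_tens _ _)).
by rewrite -!bmap_l !compA zigA.
Qed.

Lemma ev_inj X (f g : hom X B) : ev ∘ (\id ⊗⊗ f) = ev ∘ (\id ⊗⊗ g) -> f = g.
Proof. by move=> e; rewrite -[f]transposeK -[g]transposeK e. Qed.

End DualPair.

Section LeftDual.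
Variables (k : fieldType) (C : rigidcat k).

(** f and g are mates when [lev X ∘ (f ⊗⊗ \id) = lev Y ∘ (\id ⊗⊗ g)]; this pairing determines f by
    [lev_inj] and g by [transposeK]. *)
Lemma ldualm_full (X Y : C) (f : hom (ldual Y) (ldual X)) : exists! g : hom X Y, ldualm g = f.
Proof.
exists (transpose (lcoev Y) (lev X ∘ (f ⊗⊗ \id))); split.
  by apply: lev_inj; rewrite ldualmE (ev_transpose (lzigzag2 Y)).
move=> g <-; rewrite ldualmE; exact: (transposeK (lzigzag1 Y)).
Qed.

(** [rev X] exhibits X as a left dual of [rdual X]; this map and the next compare it with the chosen
    left dual. *)
Definition to_ldual_rdual (X : C) : hom X (ldual (rdual X)) := curry1 (rev X).

Definition of_ldual_rdual (X : C) : hom (ldual (rdual X)) X :=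
  mlunit X ∘ ((lev (rdual X) ⊗⊗ \id) ∘ (bwd (massoc _ (rdual X) X) ∘
    ((\id ⊗⊗ rcoev X) ∘ bwd (mrunit _)))).

Lemma of_to_ldual_rdual X : of_ldual_rdual X ∘ to_ldual_rdual X = \id.
Proof.
rewrite /of_ldual_rdual -!compA (iso_sq (mrunit_nat _)) (compR (bmap_c _ _ _)).
rewrite -(bmap1 tens (rdual X) X) (compR (massoc_nat' _ _ _)).
by rewrite (compR1 (esym (bmap_l _ _ _ _))) curry1K -[RHS](rzigzag1 X) -!compA.
Qed.

(* A right inverse amounts to [lev ∘ (of ⊗ 1) = lev]; the endomorphism of [rdual X]
   mating these two is trivial, as one sees after precomposing with [to]. *)
Lemma to_of_ldual_rdual X : to_ldual_rdual X ∘ of_ldual_rdual X = \id.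
Proof.
apply: lev_inj; rewrite bmap_l bmap1 compm1 (compR1 (curry1K _)).
pose u := transpose (lcoev (rdual X)) (rev X ∘ (of_ldual_rdual X ⊗⊗ \id)).
have uE : lev (rdual X) ∘ (\id ⊗⊗ u) = rev X ∘ (of_ldual_rdual X ⊗⊗ \id).
  exact: (ev_transpose (lzigzag2 (rdual X))).
have -> : rev X ∘ (of_ldual_rdual X ⊗⊗ \id) = lev (rdual X) ∘ (\id ⊗⊗ u) by rewrite uE.
suff -> : u = \id by rewrite bmap1 compm1.
apply: (ev_inj (rzigzag2 X)); rewrite bmap1 compm1.
rewrite -[rev X in LHS](curry1K (rev X)) -compA -bmap_c (compR1 uE).
by rewrite -compA -bmap_l of_to_ldual_rdual bmap1 compm1.
Qed.

Definition ldual_rdual_iso X : iso X (ldual (rdual X)) :=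
  Iso (of_to_ldual_rdual X) (to_of_ldual_rdual X).

End LeftDual.

Section DualBimodule.
Variables (gT : finGroupType) (k : fieldType) (C : fusioncat k) (E : grading gT C).

(* The duality isomorphisms of the trivial component, seen in [C]; they carry
   other proof terms than those of [C] and are only propositionally equal to them. *)
Definition trivial_ldual_tens (X Y : trivial_component E) :
  hom (ldual (sval Y) ⊗ ldual (sval X)) (ldual (sval X ⊗ sval Y)) := fwd (ldual_tens X Y).

Definition trivial_ldual_tens_inv (X Y : trivial_component E) :
  hom (ldual (sval X ⊗ sval Y)) (ldual (sval Y) ⊗ ldual (sval X)) := bwd (ldual_tens X Y).

Definition trivial_ldual_unit : hom (𝟙 : C) (ldual 𝟙) :=
  fwd (ldual_unit : iso (𝟙 : trivial_component E) _).

Lemma trivial_ldual_tensE X Y : trivial_ldual_tens X Y = ldual_tens (sval X) (sval Y).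
Proof. by rewrite /trivial_ldual_tens /ldual_tens -!lock. Qed.

Lemma trivial_ldual_tens_invE X Y :
  trivial_ldual_tens_inv X Y = bwd (ldual_tens (sval X) (sval Y)).
Proof. by rewrite /trivial_ldual_tens_inv /ldual_tens -!lock. Qed.

Lemma trivial_ldual_unitE : trivial_ldual_unit = ldual_unit.
Proof. by rewrite /trivial_ldual_unit /ldual_unit -!lock. Qed.

Variables (g g' : gT) (e : (g'^-1)%g = g).
Let M' := component_bimod E g'.
Let M := opbimod (component_bimod E g).

(** The equation e is a parameter because, for g' the inverse of g, duals have degree the double
    inverse of g, which equals g only propositionally. *)
Definition dual_fun : linfun M' M.
Proof.
refine (@LinFun k M' M (fun X : M' => exist _ (ldual (sval X)) (deg_eq e (deg_ldual (svalP X))) : M)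
  (fun X Y f => @ldualm k C (sval X) (sval Y) f) _ _ _).
- by move=> X; apply: (@ldualm1 k C (sval X)).
- by move=> X Y Z h f; apply: (@ldualmM k C (sval X) (sval Y) (sval Z) h f).
- by move=> X Y a f h; apply: (@ldualmP k C (sval X) (sval Y) a f h).
Defined.

Definition dual_l (X : trivial_component E) (p : M') : iso (dual_fun (X ▷ p)) (X ▷ dual_fun p) :=
  @opiso k (component E g) (exist _ _ _) (exist _ _ _) (subiso (ldual_tens (sval X) (sval p))).

Definition dual_r (p : M') (Y : trivial_component E) : iso (dual_fun (p ◁ Y)) (dual_fun p ◁ Y) :=
  @opiso k (component E g) (exist _ _ _) (exist _ _ _) (subiso (ldual_tens (sval p) (sval Y))).

(** The left, right and middle associativity laws are all [ldual_tens_assoc], with the module object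
    in last, first and middle position. *)
Definition dual_struct : bimodfun_struct dual_fun.
Proof.
refine (@BimodFunStruct k (trivial_component E) M' M dual_fun dual_l dual_r _ _ _ _ _ _ _).
- move=> X X' p p' f h.
  exact: (@ldual_tens_nat k C (sval X) (sval X') (sval p) (sval p') f h).
- move=> p p' Y Y' h f.
  exact: (@ldual_tens_nat k C (sval p) (sval p') (sval Y) (sval Y') h f).
- move=> X Y p; have A := @ldual_tens_assoc k C (sval X) (sval Y) (sval p).
  (* The axiom read in C, where composition runs in the opposite order. *)
  change (@ldual_tens k C (sval X ⊗ sval Y) (sval p) ∘
      ((\id ⊗⊗ trivial_ldual_tens X Y) ∘ massoc _ _ _) =
    @ldualm k C _ _ (massoc (sval X) (sval Y) (sval p)) ∘
      (@ldual_tens k C (sval X) (sval Y ⊗ sval p) ∘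
        (@ldual_tens k C (sval Y) (sval p) ⊗⊗ @ldualm k C _ _ (idm (sval X)))) :> hom _ _).
  by rewrite (ldualm1 (D := C)) trivial_ldual_tensE A.
- move=> p X Y; have A := @ldual_tens_assoc k C (sval p) (sval X) (sval Y).
  change (@ldualm k C _ _ (massoc (sval p) (sval X) (sval Y)) ∘
      @ldual_tens k C (sval p) (sval X ⊗ sval Y) =
    @ldual_tens k C (sval p ⊗ sval X) (sval Y) ∘
      ((@ldualm k C _ _ (idm (sval Y)) ⊗⊗ @ldual_tens k C (sval p) (sval X)) ∘
        (massoc _ _ _ ∘ (trivial_ldual_tens_inv X Y ⊗⊗ \id))) :> hom _ _).
  rewrite (ldualm1 (D := C)) trivial_ldual_tens_invE (compR2 A) -!compA.
  by rewrite -bmap_l bwdK bmap1 compm1.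
- move=> p; have A := @ldual_tens_unitl k C (sval p).
  change (@ldual_tens k C 𝟙 (sval p) ∘
      ((\id ⊗⊗ trivial_ldual_unit) ∘ bwd (mrunit _)) =
    @ldualm k C _ _ (mlunit (sval p)) :> hom _ _).
  by rewrite trivial_ldual_unitE (compR1 A) -compA bwdK compm1.
- move=> p; have A := @ldual_tens_unitr k C (sval p).
  change (@ldual_tens k C (sval p) 𝟙 ∘
      ((trivial_ldual_unit ⊗⊗ \id) ∘ bwd (mlunit _)) =
    @ldualm k C _ _ (mrunit (sval p)) :> hom _ _).
  by rewrite trivial_ldual_unitE (compR1 A) -compA bwdK compm1.
- move=> X p Y; have A := @ldual_tens_assoc k C (sval X) (sval p) (sval Y).
  change (@ldualm k C _ _ (massoc (sval X) (sval p) (sval Y)) ∘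
      (@ldual_tens k C (sval X) (sval p ⊗ sval Y) ∘
        (@ldual_tens k C (sval p) (sval Y) ⊗⊗ @ldualm k C _ _ (idm (sval X)))) =
    @ldual_tens k C (sval X ⊗ sval p) (sval Y) ∘
      ((@ldualm k C _ _ (idm (sval Y)) ⊗⊗ @ldual_tens k C (sval X) (sval p)) ∘ massoc _ _ _)
    :> hom _ _).
  by rewrite !(ldualm1 (D := C)) A.
Defined.

Lemma dual_fully_faithful : fully_faithful dual_fun.
Proof. by move=> X Y f; apply: (@ldualm_full k C (sval X) (sval Y) f). Qed.

Lemma dual_ess_surj : ess_surj dual_fun.
Proof.
move=> m; have dm : deg E g' (rdual (sval m)).
  by apply: (deg_eq _ (deg_rdual (svalP m))); rewrite -e invgK.
exists (exist _ _ dm : M'); constructor.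
exact: (@opiso k (component E g) m (dual_fun (exist _ _ dm))
  (@subiso k C _ m (dual_fun (exist _ _ dm)) (ldual_rdual_iso (sval m)))).
Qed.

End DualBimodule.

Section Identity.
Variables (k : fieldType) (D : rigidcat k).

Lemma lf_id_equivalence (A : lincat k) : is_equivalence (lf_id A).
Proof.
by exists (lf_id A); split; exists (fun X => iso_id X) => X Y f /=; rewrite comp1m compm1.
Qed.

Lemma lf_id_fully_faithful (A : lincat k) : fully_faithful (lf_id A).
Proof. by move=> X Y f; exists f; split. Qed.

Lemma lf_id_ess_surj (A : lincat k) : ess_surj (lf_id A).
Proof. by move=> X; exists X; constructor; exact: iso_id. Qed.

Lemma reltensor_equivalent_trans (M N P P' : bimodcat D) :
  reltensor_equivalent M N P -> bimod_equivalent P P' -> reltensor_equivalent M N P'.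
Proof. by move=> [inh eq] PP'; split=> // T; apply: bimod_equivalent_trans (eq T) PP'. Qed.

End Identity.

(** * Invertibility of the components *)

Section Invertibility.
Variables (gT : finGroupType) (k : fieldType) (C : fusioncat k) (E : grading gT C).

(** Stated up to an equation since it is applied to [g^-1 * g] and [g * g^-1]. The two bimodules
    differ only in their proofs of degree, so identities serve as structure. *)
Lemma component1_regular (g : gT) : g = 1%g ->
  bimod_equivalent (component_bimod E g) (regular_bimod (trivial_component E)).
Proof.
move=> ->; exists (lf_id (component E 1%g)); split; last exact: lf_id_equivalence.
constructor.
refine (@BimodFunStruct k (trivial_component E) (component_bimod E 1%g)
  (regular_bimod (trivial_component E)) (lf_id (component E 1%g))
  (fun X p => @subiso k C _ (exist _ _ _) (exist _ _ _) (iso_id (sval X ⊗ sval p)))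
  (fun p Y => @subiso k C _ (exist _ _ _) (exist _ _ _) (iso_id (sval p ⊗ sval Y)))
  _ _ _ _ _ _ _) => /=.
all: by move=> *; rewrite ?bmap1 ?comp1m ?compm1 ?bmap1 ?comp1m.
Qed.

Lemma component_invertible (faithful : faithful_grading E) (g : gT) :
  invertible_bimod (component_bimod E g).
Proof.
(* R goes from the opposite of C_g to the component of degree [g^-1]; it replaces the left factor of
   ⊗ in one half and the right factor in the other. *)
have [R [sR [ffR esR]]] := quasi_inverse_bimodfun (dual_struct E (invgK g))
  (@dual_fully_faithful _ _ _ E _ _ (invgK g)) (@dual_ess_surj _ _ _ E _ _ (invgK g)).
split.
- apply: (@reltensor_equivalent_trans _ _ _ _ (component_bimod E (g^-1 * g)%g)).
    apply: universal_reltensor_equivalent.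
    apply: (@pullback_universal _ _ _ _ _ _ _ (tens_bimodbalanced E g^-1%g g) _ _ sR
      (bimodfun_id (component_bimod E g))) => //.
    + exact: lf_id_fully_faithful.
    + exact: lf_id_ess_surj.
    + exact: (@tens_presented _ _ _ E g^-1%g g).
    + exact: (@tens_dominant _ _ _ E faithful g^-1%g g).
  exact: component1_regular (mulVg g).
- apply: (@reltensor_equivalent_trans _ _ _ _ (component_bimod E (g * g^-1)%g)).
    apply: universal_reltensor_equivalent.
    apply: (@pullback_universal _ _ _ _ _ _ _ (tens_bimodbalanced E g g^-1%g) _ _
      (bimodfun_id (component_bimod E g)) sR) => //.
    + exact: lf_id_fully_faithful.
    + exact: lf_id_ess_surj.
    + exact: (@tens_presented _ _ _ E g g^-1%g).
    + exact: (@tens_dominant _ _ _ E faithful g g^-1%g).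
  exact: component1_regular (mulgV g).
Qed.

End Invertibility.

Theorem theorem6p1 (k : closedFieldType) (char0 : [pchar k]%R =i pred0)
    (gT : finGroupType) (C : fusioncat k) (E : grading gT C)
    (faithful : faithful_grading E) :
  (forall g : gT, invertible_bimod (component_bimod E g)) /\
  (forall g h : gT, induces_bimod_equivalence (tens_bimodbalanced E g h)).
Proof.
split=> [g|g h]; first exact: component_invertible.
by apply: universal_induces; apply: tens_universal.
Qed.
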